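(* There is a one-to-one correspondence between the set $\mathfrak{c}_{prim}$ of primitive (directed) çarks, up to isomorphism, and the set of $\mathrm{PSL}_2(\mathbf{Z})$-classes of primitive indefinite binary quadratic forms having discriminant $\Delta\in\mathcal{D}$. It sends the çark $\langle M\rangle\backslash\mathcal{F}$ directed by $M$ to the class of $f_M$.
   Context: $\mathcal{D}=\{d\in\mathbf{Z}_{>0}: d\equiv 0,1 \pmod 4,\ d \text{ is not a square}\}$. Let $S(z)=-1/z$, $R(z)=(z-1)/z$. The bipartite Farey tree $\mathcal{F}$ has edges $\{W\}$, $\otimes$-vertices $\{W,WS\}$, $\bullet$-vertices $\{W,WR,WR^2\}$ ($W\in\mathrm{PSL}_2(\mathbf{Z})$); the edge $\{W\}$ joins $\{W,WS\}$ to $\{W,WR,WR^2\}$, and the edges at a $\bullet$-vertex are cyclically ordered as $(\{W\},\{WR\},\{WR^2\})$. $\mathrm{PSL}_2(\mathbf{Z})$ acts on $\mathcal{F}$ by left multiplication. A çark is the quotient ribbon graph $\langle M\rangle\backslash\mathcal{F}$ for a hyperbolic $M\in\mathrm{PSL}_2(\mathbf{Z})$ ($|\mathrm{tr}\,M|>2$). Its unique circuit, the image of the axis of $M$ in $\mathcal{F}$, is the spine. A çark is directed if an orientation of its spine is chosen; the direction given by $M$ is that in which $M$ translates its axis. Isomorphisms of directed çarks preserve the ribbon structure, the types of vertices and the direction. Going around the spine, at each $\bullet$-vertex there is one branch off the spine, on one of the two sides; this gives a cyclic binary word. A çark is primitive if its spine is not periodic, i.e. this cyclic word is aperiodic (not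 a proper power). Forms: $(A,B,C)$ denotes $Ax^2+Bxy+Cy^2$ with $A,B,C\in\mathbf{Z}$; its discriminant is $B^2-4AC$; it is primitive if $\gcd(A,B,C)=1$ and indefinite if its discriminant is positive. $\mathrm{PSL}_2(\mathbf{Z})$ acts by $(U\cdot f)(x,y)=f(U(x,y)^t)$; classes are orbits. For hyperbolic $M=\begin{pmatrix}p&q\\ r&s\end{pmatrix}$ put $f_M=\frac{\mathrm{sgn}(p+s)}{\gcd(q,s-p,r)}(r,s-p,-q)$. *)

(* Defs.v *)
From HB Require Import structures.
From mathcomp Require Import all_boot all_order all_algebra generic_quotient.
From mathcomp Require Import boolp classical_sets functions.
From mathcomp Require Import ring.

Set Implicit Arguments.
Unset Strict Implicit.
Unset Printing Implicit Defensive.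

Import Order.TTheory GRing.Theory Num.Theory.
Local Open Scope classical_set_scope.
Local Open Scope quotient_scope.
Local Open Scope ring_scope.

Record SL2Z := MkSL2Z { SL2Z_mx :> 'M[int]_2; SL2Z_det : \det SL2Z_mx == 1 }.
HB.instance Definition _ := [isSub for SL2Z_mx].
HB.instance Definition _ := [Choice of SL2Z by <:].

Lemma SL2Z_mul_subproof (A B : SL2Z) : \det (A *m B) == 1.
Proof. by rewrite det_mulmx (eqP (SL2Z_det A)) (eqP (SL2Z_det B)) mulr1. Qed.

Lemma SL2Z_one_subproof : \det (1%:M : 'M[int]_2) == 1.
Proof. by rewrite det1. Qed.

Lemma SL2Z_inv_subproof (A : SL2Z) : \det (\adj A) == 1.
Proof.
have := congr1 determinant (mul_adj_mx A).
by rewrite det_mulmx (eqP (SL2Z_det A)) mulr1 det1 => ->.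
Qed.

Lemma SL2Z_opp_subproof (A : SL2Z) : \det (- (A : 'M[int]_2)) == 1.
Proof. by rewrite -scaleN1r detZ (eqP (SL2Z_det A)) mulr1 expr2 mulrNN mulr1. Qed.

Definition SL2Z_mul (A B : SL2Z) : SL2Z := MkSL2Z (SL2Z_mul_subproof A B).
Definition SL2Z_one : SL2Z := MkSL2Z SL2Z_one_subproof.
Definition SL2Z_inv (A : SL2Z) : SL2Z := MkSL2Z (SL2Z_inv_subproof A).
Definition SL2Z_opp (A : SL2Z) : SL2Z := MkSL2Z (SL2Z_opp_subproof A).

Definition pm_eq (A B : SL2Z) : bool := (A == B) || (A == SL2Z_opp B).

Lemma pm_eqP (A B : SL2Z) :
  reflect (A = B :> 'M[int]_2 \/ A = - (B : 'M[int]_2) :> 'M[int]_2)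
          (pm_eq A B).
Proof.
apply: (iffP orP) => -[].
- by move=> /eqP ->; left.
- by move=> /eqP ->; right.
- by move=> h; left; apply/eqP/val_inj.
- by move=> h; right; apply/eqP/val_inj.
Qed.

Lemma pm_eq_refl : reflexive pm_eq.
Proof. by move=> A; apply/pm_eqP; left. Qed.

Lemma pm_eq_sym : symmetric pm_eq.
Proof.
suff h A B : pm_eq A B -> pm_eq B A by move=> A B; apply/idP/idP; apply: h.
by move=> /pm_eqP[] h; apply/pm_eqP; rewrite h ?opprK; [left|right].
Qed.

Lemma pm_eq_trans : transitive pm_eq.
Proof.
by move=> B A C /pm_eqP[] h /pm_eqP[] k; apply/pm_eqP; rewrite h k ?opprK; auto.
Qed.

Canonical pm_equiv := EquivRel pm_eq pm_eq_refl pm_eq_sym pm_eq_trans.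

Definition PSL2Z := {eq_quot pm_equiv}.
HB.instance Definition _ := Choice.on PSL2Z.
HB.instance Definition _ := EqQuotient.on PSL2Z.

Lemma PSL2Z_eqP (A B : SL2Z) :
  \pi_PSL2Z A = \pi_PSL2Z B <->
  A = B :> 'M[int]_2 \/ A = - (B : 'M[int]_2) :> 'M[int]_2.
Proof.
by split=> [/eqmodP/pm_eqP|h]; [|apply/eqmodP/pm_eqP].
Qed.

Lemma repr_PSL2Z (A : SL2Z) :
  let B := repr (\pi_PSL2Z A) in
  B = A :> 'M[int]_2 \/ B = - (A : 'M[int]_2) :> 'M[int]_2.
Proof. by apply/PSL2Z_eqP; rewrite reprK. Qed.

Definition PSL2Z_mul (U V : PSL2Z) : PSL2Z :=
  \pi_PSL2Z (SL2Z_mul (repr U) (repr V)).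
Definition PSL2Z_one : PSL2Z := \pi_PSL2Z SL2Z_one.
Definition PSL2Z_inv (U : PSL2Z) : PSL2Z := \pi_PSL2Z (SL2Z_inv (repr U)).

Lemma pi_mul (A B : SL2Z) :
  PSL2Z_mul (\pi_PSL2Z A) (\pi_PSL2Z B) = \pi_PSL2Z (SL2Z_mul A B).
Proof.
apply/PSL2Z_eqP => /=.
case: (repr_PSL2Z A) => ->; case: (repr_PSL2Z B) => ->;
  rewrite ?mulNmx ?mulmxN ?opprK; by [left|right].
Qed.

Lemma PSL2Z_mulA : associative PSL2Z_mul.
Proof.
elim/quotW=> A; elim/quotW=> B; elim/quotW=> C.
rewrite (pi_mul B C) (pi_mul A B) !pi_mul.
by apply/PSL2Z_eqP; left; rewrite /= mulmxA.
Qed.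

Lemma PSL2Z_mul1 : left_id PSL2Z_one PSL2Z_mul.
Proof.
by elim/quotW=> A; rewrite pi_mul; apply/PSL2Z_eqP; left; rewrite /= mul1mx.
Qed.

Lemma PSL2Z_mul1r : right_id PSL2Z_one PSL2Z_mul.
Proof.
by elim/quotW=> A; rewrite pi_mul; apply/PSL2Z_eqP; left; rewrite /= mulmx1.
Qed.

Lemma PSL2Z_mulV : left_inverse PSL2Z_one PSL2Z_inv PSL2Z_mul.
Proof.
move=> U; rewrite -{2}[U]reprK pi_mul; apply/PSL2Z_eqP; left.
by rewrite /= mul_adj_mx (eqP (SL2Z_det _)).
Qed.

Lemma PSL2Z_mulVr : right_inverse PSL2Z_one PSL2Z_inv PSL2Z_mul.
Proof.
move=> U; rewrite -{1}[U]reprK pi_mul; apply/PSL2Z_eqP; left.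
by rewrite /= mul_mx_adj (eqP (SL2Z_det _)).
Qed.

HB.instance Definition _ := isGroup.Build PSL2Z
  PSL2Z_mulA PSL2Z_mul1 PSL2Z_mul1r PSL2Z_mulV PSL2Z_mulVr.

Definition mx22 (p q r s : int) : 'M[int]_2 :=
  \matrix_(i < 2, j < 2)
    if i == 0 then (if j == 0 then p else q) else (if j == 0 then r else s).

Lemma det_mx22 p q r s : \det (mx22 p q r s) = p * s - q * r.
Proof.
rewrite (expand_det_row _ ord0) !big_ord_recl big_ord0 /cofactor !det_mx11.
by rewrite !mxE /= expr0 expr1 mul1r mulN1r addr0 mulrN.
Qed.

Lemma mod_S_det : \det (mx22 0 (-1) 1 0) == 1.
Proof. by rewrite det_mx22. Qed.

Lemma mod_R_det : \det (mx22 1 (-1) 1 0) == 1.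
Proof. by rewrite det_mx22. Qed.

(* z |-> -1/z and z |-> (z - 1)/z *)
Definition mod_S : PSL2Z := \pi_PSL2Z (MkSL2Z mod_S_det).
Definition mod_R : PSL2Z := \pi_PSL2Z (MkSL2Z mod_R_det).

Lemma mod_SS : (mod_S * mod_S = 1)%g.
Proof.
rewrite [LHS]pi_mul; apply/PSL2Z_eqP; right; apply/matrixP => i j.
rewrite !mxE !big_ord_recl big_ord0 !mxE /=.
by case: i => -[|[|//]] ?; case: j => -[|[|//]] ?.
Qed.

Lemma mod_RRR : (mod_R * mod_R * mod_R = 1)%g.
Proof.
rewrite [(mod_R * mod_R)%g]pi_mul [LHS]pi_mul.
apply/PSL2Z_eqP; right; apply/matrixP => i j.
rewrite !mxE !big_ord_recl big_ord0 !mxE /= !big_ord_recl !big_ord0 !mxE /=.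
by case: i => -[|[|//]] ?; case: j => -[|[|//]] ?.
Qed.

Definition hyperbolic (M : PSL2Z) : Prop := 2 < `|\tr (repr M)|.

Lemma hyperbolic_pi (A : SL2Z) : hyperbolic (\pi_PSL2Z A) <-> 2 < `|\tr A|.
Proof.
by rewrite /hyperbolic; case: (repr_PSL2Z A) => ->; rewrite ?raddfN ?normrN.
Qed.

(* A bipartite graph given by its edges, each joining a (x)-vertex [oend e] to
   a *-vertex [bend e], with for every vertex a cyclic order of the edges at
   that vertex: [onext e] and [bnext e] are the successors of [e] in the cyclic
   orders at [oend e] and at [bend e].  The fields [_next_trans] say that the
   edges at a vertex form a single cycle. *)
Record ribbonGraph := RibbonGraph {
  edge : Type;
  overt : Type;
  bvert : Type;
  oend : edge -> overt;
  bend : edge -> bvert;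
  onext : edge -> edge;
  bnext : edge -> edge;
  oend_next : forall e, oend (onext e) = oend e;
  bend_next : forall e, bend (bnext e) = bend e;
  onext_trans : forall e e', oend e = oend e' -> exists n, iter n onext e = e';
  bnext_trans : forall e e', bend e = bend e' -> exists n, iter n bnext e = e'
}.

Record ribbonIso (G H : ribbonGraph) := RibbonIso {
  isoE :> edge G -> edge H;
  isoO : overt G -> overt H;
  isoB : bvert G -> bvert H;
  isoE_bij : bijective isoE;
  isoO_bij : bijective isoO;
  isoB_bij : bijective isoB;
  iso_oend : forall e, oend (isoE e) = isoO (oend e);
  iso_bend : forall e, bend (isoE e) = isoB (bend e);
  iso_onext : forall e, onext (isoE e) = isoE (onext e);
  iso_bnext : forall e, bnext (isoE e) = isoE (bnext e)
}.

(* The orbit of [x] under the group generated by the permutation [f]. *)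
Definition cyc_orbit (T : Type) (f : T -> T) (x : T) : set T :=
  [set y | exists n, iter n f x = y \/ iter n f y = x].

Lemma cyc_orbit_refl T (f : T -> T) x : cyc_orbit f x x.
Proof. by exists 0%N; left. Qed.

Lemma iter_sub T (f : T -> T) m n x y :
  injective f -> (m <= n)%N -> iter n f x = iter m f y -> iter (n - m) f x = y.
Proof.
move=> injf; elim: m n => [|m IHm] [|n] //= lemn.
by move=> /injf /(IHm _ lemn); rewrite subSS.
Qed.

Lemma cyc_orbit_eq T (f : T -> T) x y :
  injective f -> cyc_orbit f x y -> cyc_orbit f x = cyc_orbit f y.
Proof.
move=> injf.
have sym u v : cyc_orbit f u v -> cyc_orbit f v u.
  by move=> [n [h|h]]; exists n; [right|left].
have tr u v w : cyc_orbit f u v -> cyc_orbit f v w -> cyc_orbit f u w.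
  move=> [m [hm|hm]] [n [hn|hn]].
  - by exists (n + m)%N; left; rewrite iterD hm.
  - have [le|/ltnW le] := leqP n m.
      by exists (m - n)%N; left; apply: iter_sub; rewrite // hm hn.
    by exists (n - m)%N; right; apply: iter_sub; rewrite // hm hn.
  - have [le|/ltnW le] := leqP n m.
      by exists (m - n)%N; right; rewrite -hn -hm -iterD subnK.
    by exists (n - m)%N; left; rewrite -hm -hn -iterD subnK.
  - by exists (m + n)%N; right; rewrite iterD hn.
move=> hxy; apply/seteqP; split => z; last exact: tr.
exact/tr/sym.
Qed.

Lemma image_cyc_orbit T U (f : T -> T) (g : U -> U) (h : T -> U) x :
  bijective f -> injective g -> (forall y, g (h y) = h (f y)) ->
  h @` cyc_orbit f x = cyc_orbit g (h x).
Proof.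
move=> [f' fK f'K] injg gh.
have iterh n y : iter n g (h y) = h (iter n f y).
  by elim: n => //= n ->; rewrite gh.
have iterK n y : iter n f (iter n f' y) = y.
  by elim: n y => //= n IHn y; rewrite -iterS iterSr f'K.
apply/seteqP; split=> [_ [y [n [<-|<-]] <-]|z [n [<-|hz]]].
- by exists n; left; rewrite iterh.
- by exists n; right; rewrite iterh.
- by exists (iter n f x); [exists n; left|rewrite iterh].
- exists (iter n f' x); first by exists n; right.
  have injn : injective (iter n g) by elim: n {hz} => //= n IHn y1 y2 /injg/IHn.
  by apply: injn; rewrite iterh iterK hz.
Qed.

Section Quotient.
Variables (G : ribbonGraph) (m : ribbonIso G G).

Let injE : injective m := bij_inj (isoE_bij m).
Let injO : injective (isoO m) := bij_inj (isoO_bij m).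
Let injB : injective (isoB m) := bij_inj (isoB_bij m).

Definition quot_edge : Type := range (cyc_orbit m).
Definition quot_overt : Type := range (cyc_orbit (isoO m)).
Definition quot_bvert : Type := range (cyc_orbit (isoB m)).

Definition edge_proj (e : edge G) : quot_edge :=
  SigSub (mem_set (imageT (cyc_orbit m) e)).

Lemma quot_edgeP (x : quot_edge) : exists e, x = edge_proj e.
Proof. by case: (set_valP x) => e _ h; exists e; apply/val_inj. Qed.

Lemma quot_oend_subproof (x : quot_edge) :
  range (cyc_orbit (isoO m)) (@oend G @` val x).
Proof.
case: (quot_edgeP x) => e ->; exists (oend e) => //; symmetry.
apply: image_cyc_orbit => [||y]; [exact: isoE_bij|exact: injO|].
by rewrite iso_oend.
Qed.

Lemma quot_bend_subproof (x : quot_edge) :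
  range (cyc_orbit (isoB m)) (@bend G @` val x).
Proof.
case: (quot_edgeP x) => e ->; exists (bend e) => //; symmetry.
apply: image_cyc_orbit => [||y]; [exact: isoE_bij|exact: injB|].
by rewrite iso_bend.
Qed.

Lemma image_onext e : @onext G @` cyc_orbit m e = cyc_orbit m (onext e).
Proof.
apply: image_cyc_orbit => [||y]; [exact: isoE_bij|exact: injE|].
by rewrite iso_onext.
Qed.

Lemma image_bnext e : @bnext G @` cyc_orbit m e = cyc_orbit m (bnext e).
Proof.
apply: image_cyc_orbit => [||y]; [exact: isoE_bij|exact: injE|].
by rewrite iso_bnext.
Qed.

Lemma quot_onext_subproof (x : quot_edge) :
  range (cyc_orbit m) (@onext G @` val x).
Proof. by case: (quot_edgeP x) => e ->; exists (onext e); rewrite ?image_onext. Qed.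

Lemma quot_bnext_subproof (x : quot_edge) :
  range (cyc_orbit m) (@bnext G @` val x).
Proof. by case: (quot_edgeP x) => e ->; exists (bnext e); rewrite ?image_bnext. Qed.

Definition quot_oend (x : quot_edge) : quot_overt :=
  SigSub (mem_set (quot_oend_subproof x)).
Definition quot_bend (x : quot_edge) : quot_bvert :=
  SigSub (mem_set (quot_bend_subproof x)).
Definition quot_onext (x : quot_edge) : quot_edge :=
  SigSub (mem_set (quot_onext_subproof x)).
Definition quot_bnext (x : quot_edge) : quot_edge :=
  SigSub (mem_set (quot_bnext_subproof x)).

Lemma quot_onext_proj e : quot_onext (edge_proj e) = edge_proj (onext e).
Proof. by apply/val_inj; exact: image_onext. Qed.

Lemma quot_bnext_proj e : quot_bnext (edge_proj e) = edge_proj (bnext e).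
Proof. by apply/val_inj; exact: image_bnext. Qed.

Lemma edge_proj_orbit e e' : cyc_orbit m e e' -> edge_proj e = edge_proj e'.
Proof. by move=> h; apply/val_inj/cyc_orbit_eq. Qed.

Lemma quot_oend_next x : quot_oend (quot_onext x) = quot_oend x.
Proof.
apply/val_inj; rewrite /= image_comp.
by congr image; apply/funext => e /=; rewrite oend_next.
Qed.

Lemma quot_bend_next x : quot_bend (quot_bnext x) = quot_bend x.
Proof.
apply/val_inj; rewrite /= image_comp.
by congr image; apply/funext => e /=; rewrite bend_next.
Qed.

Lemma quot_onext_trans x y :
  quot_oend x = quot_oend y -> exists n, iter n quot_onext x = y.
Proof.
case: (quot_edgeP x) (quot_edgeP y) => e -> [e' ->] /(congr1 val) /= h.
have : (@oend G @` cyc_orbit m e) (oend e) by exists e => //; exact: cyc_orbit_refl.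
rewrite h => -[e'' he'' /esym/onext_trans[n hn]].
exists n; rewrite (edge_proj_orbit he'') -hn.
by elim: n {hn} => //= n ->; rewrite quot_onext_proj.
Qed.

Lemma quot_bnext_trans x y :
  quot_bend x = quot_bend y -> exists n, iter n quot_bnext x = y.
Proof.
case: (quot_edgeP x) (quot_edgeP y) => e -> [e' ->] /(congr1 val) /= h.
have : (@bend G @` cyc_orbit m e) (bend e) by exists e => //; exact: cyc_orbit_refl.
rewrite h => -[e'' he'' /esym/bnext_trans[n hn]].
exists n; rewrite (edge_proj_orbit he'') -hn.
by elim: n {hn} => //= n ->; rewrite quot_bnext_proj.
Qed.

Definition quot_graph : ribbonGraph :=
  RibbonGraph quot_oend_next quot_bend_next quot_onext_trans quot_bnext_trans.

End Quotient.

Section Farey.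
Local Open Scope group_scope.

(* The edge {W} is identified with W. *)
Definition overt_set (W : PSL2Z) : set PSL2Z := [set W; W * mod_S].
Definition bvert_set (W : PSL2Z) : set PSL2Z :=
  [set W; W * mod_R] `|` [set W * mod_R * mod_R].

Definition farey_overt : Type := range overt_set.
Definition farey_bvert : Type := range bvert_set.

Definition farey_oend (W : PSL2Z) : farey_overt :=
  SigSub (mem_set (imageT overt_set W)).
Definition farey_bend (W : PSL2Z) : farey_bvert :=
  SigSub (mem_set (imageT bvert_set W)).

Lemma farey_oend_next W : farey_oend (W * mod_S) = farey_oend W.
Proof.
apply/val_inj; rewrite /= /overt_set -mulgA mod_SS mulg1.
by rewrite setUC.
Qed.

Lemma farey_bend_next W : farey_bend (W * mod_R) = farey_bend W.
Proof.
apply/val_inj; rewrite /= /bvert_set -!mulgA [mod_R * (mod_R * mod_R)]mulgA.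
by rewrite mod_RRR mulg1 [LHS]setUC setUA.
Qed.

Lemma farey_onext_trans W W' : farey_oend W = farey_oend W' ->
  exists n, iter n ( *%g^~ mod_S) W = W'.
Proof.
move=> /(congr1 val) /= h; have : overt_set W' W' by left.
by rewrite -h => -[->|->]; [exists 0%N|exists 1%N].
Qed.

Lemma farey_bnext_trans W W' : farey_bend W = farey_bend W' ->
  exists n, iter n ( *%g^~ mod_R) W = W'.
Proof.
move=> /(congr1 val) /= h; have : bvert_set W' W' by left; left.
by rewrite -h => -[[->|->]|->]; [exists 0%N|exists 1%N|exists 2%N].
Qed.

(* The cyclic order at a *-vertex is ({W}, {WR}, {WR^2}). *)
Definition farey : ribbonGraph :=
  RibbonGraph farey_oend_next farey_bend_next farey_onext_trans
              farey_bnext_trans.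

Lemma image_overt_set N W : *%g N @` overt_set W = overt_set (N * W).
Proof. by rewrite /overt_set image_setU !image_set1 mulgA. Qed.

Lemma image_bvert_set N W : *%g N @` bvert_set W = bvert_set (N * W).
Proof. by rewrite /bvert_set !image_setU !image_set1 !mulgA. Qed.

Lemma farey_actO_subproof N (v : farey_overt) : range overt_set ( *%g N @` val v).
Proof. by case: (set_valP v) => W _ <-; exists (N * W); rewrite ?image_overt_set. Qed.

Lemma farey_actB_subproof N (v : farey_bvert) : range bvert_set ( *%g N @` val v).
Proof. by case: (set_valP v) => W _ <-; exists (N * W); rewrite ?image_bvert_set. Qed.

Definition farey_actO N (v : farey_overt) : farey_overt :=
  SigSub (mem_set (farey_actO_subproof N v)).
Definition farey_actB N (v : farey_bvert) : farey_bvert :=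
  SigSub (mem_set (farey_actB_subproof N v)).

Lemma image_mulgK (N : PSL2Z) (X : set PSL2Z) : *%g N^-1 @` ( *%g N @` X) = X.
Proof.
rewrite image_comp -[RHS]image_id.
by congr image; apply/funext => W /=; rewrite mulKg.
Qed.

Lemma image_mulgVK (N : PSL2Z) (X : set PSL2Z) : *%g N @` ( *%g N^-1 @` X) = X.
Proof. by have := image_mulgK N^-1 X; rewrite invgK. Qed.

Lemma farey_actE_bij (N : PSL2Z) : bijective ( *%g N).
Proof. by exists ( *%g N^-1) => W; rewrite ?mulKg ?mulVKg. Qed.

Lemma farey_actO_bij N : bijective (farey_actO N).
Proof.
by exists (farey_actO N^-1) => v; apply/val_inj; rewrite /= ?image_mulgK ?image_mulgVK.
Qed.

Lemma farey_actB_bij N : bijective (farey_actB N).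
Proof.
by exists (farey_actB N^-1) => v; apply/val_inj; rewrite /= ?image_mulgK ?image_mulgVK.
Qed.

Lemma farey_act_oend N W : farey_oend (N * W) = farey_actO N (farey_oend W).
Proof. by apply/val_inj; rewrite /= image_overt_set. Qed.

Lemma farey_act_bend N W : farey_bend (N * W) = farey_actB N (farey_bend W).
Proof. by apply/val_inj; rewrite /= image_bvert_set. Qed.

Definition farey_act (N : PSL2Z) : ribbonIso farey farey :=
  @RibbonIso farey farey ( *%g N) (farey_actO N) (farey_actB N)
    (farey_actE_bij N) (farey_actO_bij N) (farey_actB_bij N)
    (farey_act_oend N) (farey_act_bend N)
    (fun W => esym (mulgA N W mod_S)) (fun W => esym (mulgA N W mod_R)).

End Farey.

(* <M>\F; it is a cark when M is hyperbolic. *)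
Definition cark (M : PSL2Z) : ribbonGraph := quot_graph (farey_act M).

Definition cark_proj (M W : PSL2Z) : edge (cark M) :=
  edge_proj (farey_act M) W.

(* A bi-infinite path without backtracking, as the sequence of its edges;
   [l (2 k)] and [l (2 k + 1)] meet at a (x)-vertex, [l (2 k + 1)] and
   [l (2 k + 2)] at a *-vertex. *)
Definition is_line (G : ribbonGraph) (l : int -> edge G) : Prop :=
  forall k : int,
    [/\ l (2 * k) <> l (2 * k + 1),
        oend (l (2 * k)) = oend (l (2 * k + 1)),
        l (2 * k + 1) <> l (2 * k + 2) &
        bend (l (2 * k + 1)) = bend (l (2 * k + 2))].

(* [l] runs along the axis of M, in the direction in which M translates it. *)
Definition axis_line (M : PSL2Z) (l : int -> edge farey) : Prop :=
  is_line l /\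
  exists2 n : nat, (0 < n)%N & forall i : int, farey_act M (l i) = l (i + n%:Z).

Definition spine (M : PSL2Z) : set (edge (cark M)) :=
  [set x | exists l i, axis_line M l /\ x = cark_proj M (l i)].
Arguments spine : clear implicits.

(* An orientation of a circuit is encoded by the set X of those edges of the
   circuit that are traversed from their (x)-vertex to their *-vertex.  It is
   coherent when, of two edges of the circuit that meet at a vertex, one enters
   that vertex and the other one leaves it. *)
Definition is_orientation (G : ribbonGraph) (circuit X : set (edge G)) : Prop :=
  X `<=` circuit /\
  forall e e', circuit e -> circuit e' -> e <> e' ->
    oend e = oend e' \/ bend e = bend e' -> (X e <-> ~ X e').

Record dcark_data :=
  DCarkData { dc_mat : PSL2Z; dc_dir : set (edge (cark dc_mat)) }.
Arguments dc_dir : clear implicits.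

Definition is_directed_cark (d : dcark_data) : Prop :=
  hyperbolic (dc_mat d) /\ is_orientation (spine (dc_mat d)) (dc_dir d).

Definition directed_by (M : PSL2Z) : dcark_data :=
  @DCarkData M
    [set x | exists l k, axis_line M l /\ x = cark_proj M (l (2 * k + 1))].

Definition dcark_iso (d d' : dcark_data) : Prop :=
  exists phi : ribbonIso (cark (dc_mat d)) (cark (dc_mat d')),
    phi @` dc_dir d = dc_dir d'.

Definition dcark_class (d : dcark_data) : set dcark_data :=
  [set d' | is_directed_cark d' /\ dcark_iso d d'].

(* [w], up to rotation, is the cyclic word of [d]: [e 0], ..., [e (n - 1)] are
   the edges by which one enters the successive *-vertices when going once
   around the spine, [f] is the edge by which one leaves the i-th *-vertex, and
   the i-th letter tells whether the branch at that vertex is the edge that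
   follows [e i] in the cyclic order or the one that precedes it. *)
Definition spine_word (d : dcark_data) (w : seq bool) : Prop :=
  let n := size w in
  exists e : nat -> edge (cark (dc_mat d)),
    [/\ (0 < n)%N /\ e n = e 0%N,
        forall i j, (i < n)%N -> (j < n)%N -> e i = e j -> i = j,
        dc_dir d = e @` `I_n,
        forall i, (i < n)%N -> exists f,
          [/\ spine (dc_mat d) f, f <> e i, bend f = bend (e i),
              f <> e i.+1 & oend f = oend (e i.+1)] &
        forall i, (i < n)%N ->
          nth false w i <-> ~ spine (dc_mat d) (bnext (e i))].

Definition proper_power (T : Type) (w : seq T) : Prop :=
  exists u k, (1 < k)%N /\ w = flatten (nseq k u).

Definition is_primitive_cark (d : dcark_data) : Prop :=
  exists2 w, spine_word d w & ~ proper_power w.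

Definition prim_cark_classes : set (set dcark_data) :=
  [set dcark_class d | d in
    [set d | is_directed_cark d /\ is_primitive_cark d]].

(* [BQF A B C] is A x^2 + B x y + C y^2. *)
Record bqf := BQF { bqA : int; bqB : int; bqC : int }.

Definition bqf_eval (f : bqf) (v : 'cV[int]_2) : int :=
  let x := v ord0 0 in let y := v ord_max 0 in
  bqA f * x ^+ 2 + bqB f * x * y + bqC f * y ^+ 2.

Definition bqf_disc (f : bqf) : int := bqB f ^+ 2 - 4 * bqA f * bqC f.

Definition bqf_primitive (f : bqf) : Prop :=
  gcdz (gcdz (bqA f) (bqB f)) (bqC f) = 1.

Definition bqf_indefinite (f : bqf) : Prop := 0 < bqf_disc f.

Definition mx_act (U : 'M[int]_2) (f : bqf) : bqf :=
  let p := U ord0 ord0 in let q := U ord0 ord_max in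
  let r := U ord_max ord0 in let s := U ord_max ord_max in
  BQF (bqA f * p ^+ 2 + bqB f * p * r + bqC f * r ^+ 2)
      (2 * bqA f * p * q + bqB f * (p * s + q * r) + 2 * bqC f * r * s)
      (bqA f * q ^+ 2 + bqB f * q * s + bqC f * s ^+ 2).

Lemma mx_act_eval U f v : bqf_eval (mx_act U f) v = bqf_eval f (U *m v).
Proof.
rewrite /bqf_eval /= !mxE !big_ord_recl !big_ord0.
have -> : lift ord0 ord0 = ord_max :> 'I_2 by apply/val_inj.
ring.
Qed.

Definition bqf_act (U : PSL2Z) (f : bqf) : bqf := mx_act (repr U) f.

Lemma bqf_act_pi (A : SL2Z) f : bqf_act (\pi_PSL2Z A) f = mx_act A f.
Proof.
rewrite /bqf_act; case: (repr_PSL2Z A) => -> //.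
by rewrite /mx_act !mxE; congr BQF; ring.
Qed.

Definition bqf_class (f : bqf) : set bqf := range (bqf_act^~ f).

Definition discD : set int :=
  [set d | [/\ 0 < d, (d %% 4)%Z = 0 \/ (d %% 4)%Z = 1 &
               ~ exists n : int, d = n ^+ 2]].

Definition bqf_classes : set (set bqf) :=
  [set bqf_class f | f in
    [set f | [/\ bqf_primitive f, bqf_indefinite f & discD (bqf_disc f)]]].

(* The roots of this form are the fixed points of [A]; the divisions by [g] are
   exact, and [sg] makes the form the same for [A] and for [- A]. *)
Definition mx_form (A : 'M[int]_2) : bqf :=
  let p := A ord0 ord0 in let q := A ord0 ord_max in
  let r := A ord_max ord0 in let s := A ord_max ord_max in
  let g := gcdz (gcdz q (s - p)) r in
  let sg := Num.sg (p + s) in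
  BQF ((sg * r) %/ g)%Z ((sg * (s - p)) %/ g)%Z ((sg * - q) %/ g)%Z.

Definition form_of (M : PSL2Z) : bqf := mx_form (repr M).

Lemma form_of_pi (A : SL2Z) : form_of (\pi_PSL2Z A) = mx_form A.
Proof.
rewrite /form_of; case: (repr_PSL2Z A) => -> //.
rewrite /mx_form !mxE -!opprD !sgrN !mulrNN.
by rewrite /gcdz !abszN.
Qed.

(* Main.v *)
Require Import Defs.
From mathcomp Require Import all_boot all_algebra.
From mathcomp Require Import classical_sets functions.
From mathcomp Require Import all_order generic_quotient boolp zify ring.

(* The Farey tree is a graph built on G = PSL2(Z): its edges are the
   elements of G, and walking along a line without backtracking multiplies on
   the right by the letters SR = [1,0;-1,1] and SR^2 = [1,-1;0,1].  Up to sign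
   the products of letters are exactly the matrices of SL2(Z) with nonnegative
   diagonal and nonpositive off-diagonal entries, and they form a free monoid.
   So an edge W lies on the axis of M, with the right type and direction, iff
   W^-1 M W is a word, iff the form f_M o W = (A, B, C) has A < 0 < C.  Gauss
   reduction provides such a W, and a sign argument shows that two of them
   differ by a word, up to a power of M.  Hence a directed cark is determined up
   to isomorphism by the conjugacy class of a hyperbolic N, which is M or M^-1
   according to the direction, its cyclic words are the words conjugate to N,
   and it is primitive iff N is not a proper power.
   Reduced forms (A < 0 < C) of given discriminant are finitely many and each is
   mapped to a reduced one by a letter, so up to equivalence every form has an
   automorph that is a nonempty word.  Hyperbolic matrices with the same form
   commute, so they are conjugate to commuting words, which are powers of a
   common word. *)

Set Implicit Arguments.
Unset Strict Implicit.
Unset Printing Implicit Defensive.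

Import Order.TTheory GRing.Theory Num.Theory.
Local Open Scope classical_set_scope.
Local Open Scope quotient_scope.
Local Open Scope ring_scope.

(** * Matrices of the modular group *)

(** A relation rather than a function: the entries are defined only up to a common sign, and either
    lift can be used. *)
Definition is_mx (U : PSL2Z) (p q r s : int) : Prop :=
  exists2 A : SL2Z, U = \pi_PSL2Z A & A = mx22 p q r s :> 'M[int]_2.

Lemma mx22_eta (A : 'M[int]_2) :
  A = mx22 (A ord0 ord0) (A ord0 ord_max) (A ord_max ord0) (A ord_max ord_max).
Proof.
apply/matrixP => i j; rewrite mxE.
by case: i => -[|[|//]] ?; case: j => -[|[|//]] ? /=; congr (A _ _); apply/val_inj.
Qed.

Lemma is_mx_det U p q r s : is_mx U p q r s -> p * s - q * r = 1.
Proof. by move=> [A _ hA]; rewrite -det_mx22 -hA (eqP (SL2Z_det A)). Qed.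

Lemma is_mxP U : exists p q r s, is_mx U p q r s.
Proof.
by move: U; elim/quotW => A; do 4!eexists; exists A; [|exact: mx22_eta].
Qed.

Lemma is_mx_build p q r s : p * s - q * r = 1 -> exists U, is_mx U p q r s.
Proof.
move=> h; have d : \det (mx22 p q r s) == 1 by rewrite det_mx22 h.
by exists (\pi_PSL2Z (MkSL2Z d)), (MkSL2Z d).
Qed.

Lemma mx22_mul p q r s a b c d :
  mx22 p q r s *m mx22 a b c d =
  mx22 (p * a + q * c) (p * b + q * d) (r * a + s * c) (r * b + s * d).
Proof.
apply/matrixP => i j; rewrite !mxE !big_ord_recl big_ord0 addr0 !mxE /=.
by case: i => -[|[|//]] ?; case: j => -[|[|//]] ?.
Qed.

Lemma mx22_opp p q r s : - mx22 p q r s = mx22 (- p) (- q) (- r) (- s).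
Proof.
apply/matrixP => i j; rewrite !mxE.
by case: i => -[|[|//]] ?; case: j => -[|[|//]] ?.
Qed.

Lemma mx22_inj p q r s a b c d :
  mx22 p q r s = mx22 a b c d -> [/\ p = a, q = b, r = c & s = d].
Proof.
by move=> h; split; [move: (congr1 (fun A : 'M_2 => A ord0 ord0) h)
 |move: (congr1 (fun A : 'M_2 => A ord0 ord_max) h)
 |move: (congr1 (fun A : 'M_2 => A ord_max ord0) h)
 |move: (congr1 (fun A : 'M_2 => A ord_max ord_max) h)]; rewrite !mxE.
Qed.

Lemma is_mx_mul U V p q r s a b c d : is_mx U p q r s -> is_mx V a b c d ->
  is_mx (U * V)%g (p * a + q * c) (p * b + q * d) (r * a + s * c) (r * b + s * d).
Proof.
move=> [A -> hA] [B -> hB]; exists (SL2Z_mul A B); first by rewrite [LHS]Defs.pi_mul.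
by rewrite /= hA hB mx22_mul.
Qed.

Lemma is_mx_one : is_mx 1%g 1 0 0 1.
Proof. by exists SL2Z_one => //=; rewrite [LHS]mx22_eta !mxE. Qed.

Lemma is_mx_uniq U V p q r s : is_mx U p q r s -> is_mx V p q r s -> U = V.
Proof. by move=> [A -> hA] [B -> hB]; apply/PSL2Z_eqP; left; rewrite hA hB. Qed.

Lemma is_mx_opp U p q r s : is_mx U p q r s -> is_mx U (- p) (- q) (- r) (- s).
Proof.
move=> [A -> hA]; exists (SL2Z_opp A); last by rewrite /= hA mx22_opp.
by apply/PSL2Z_eqP; right; rewrite /= opprK.
Qed.

Lemma is_mx_inj U p q r s a b c d : is_mx U p q r s -> is_mx U a b c d ->
  [/\ p = a, q = b, r = c & s = d] \/ [/\ p = - a, q = - b, r = - c & s = - d].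
Proof.
move=> [A -> hA] [B /PSL2Z_eqP]; rewrite hA => -[] h hB.
  by left; apply: mx22_inj; rewrite h hB.
by right; apply: mx22_inj; rewrite h hB mx22_opp.
Qed.

Lemma is_mx_inv U p q r s : is_mx U p q r s -> is_mx U^-1%g s (- q) (- r) p.
Proof.
move=> hU; have [V hV] : exists V, is_mx V s (- q) (- r) p.
  by apply: is_mx_build; rewrite -(is_mx_det hU); ring.
suff e : (V * U)%g = 1%g by rewrite -[U^-1%g]mul1g -e mulgK.
apply: is_mx_uniq (is_mx_mul hV hU) _.
have d := is_mx_det hU.
have [-> -> -> ->] : [/\ s * p + - q * r = 1, s * q + - q * s = 0,
  - r * p + p * r = 0 & - r * q + p * s = 1]; last exact: is_mx_one.
by split; rewrite -?d; ring.
Qed.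

Lemma is_mx_S : is_mx mod_S 0 (-1) 1 0.
Proof. by exists (MkSL2Z mod_S_det). Qed.

Lemma is_mx_R : is_mx mod_R 1 (-1) 1 0.
Proof. by exists (MkSL2Z mod_R_det). Qed.

Lemma hyperbolicE U p q r s : is_mx U p q r s -> hyperbolic U <-> 2 < `|p + s|.
Proof.
move=> [A -> hA]; rewrite hyperbolic_pi hA /mxtrace !big_ord_recl big_ord0 addr0.
by rewrite !mxE.
Qed.

Lemma bqf_actE U p q r s A B C : is_mx U p q r s -> bqf_act U (BQF A B C) =
  BQF (A * p ^+ 2 + B * p * r + C * r ^+ 2)
      (2 * A * p * q + B * (p * s + q * r) + 2 * C * r * s)
      (A * q ^+ 2 + B * q * s + C * s ^+ 2).
Proof. by move=> [X -> hX]; rewrite bqf_act_pi hX /mx_act !mxE. Qed.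

Lemma form_ofE U p q r s : is_mx U p q r s ->
  form_of U = let g := gcdz (gcdz q (s - p)) r in let sg := Num.sg (p + s) in
  BQF ((sg * r) %/ g)%Z ((sg * (s - p)) %/ g)%Z ((sg * - q) %/ g)%Z.
Proof. by move=> [A -> hA]; rewrite form_of_pi hA /mx_form !mxE. Qed.

Lemma bqf_act1 f : bqf_act 1%g f = f.
Proof. by case: f => A B C; rewrite (bqf_actE _ _ _ is_mx_one); congr BQF; ring. Qed.

Lemma bqf_actM U V f : bqf_act (U * V)%g f = bqf_act V (bqf_act U f).
Proof.
case: f => A B C; have [p [q [r [s hU]]]] := is_mxP U.
have [a [b [c [d hV]]]] := is_mxP V.
rewrite (bqf_actE _ _ _ (is_mx_mul hU hV)) (bqf_actE _ _ _ hU) (bqf_actE _ _ _ hV).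
by congr BQF; ring.
Qed.

Lemma bqf_disc_act U f : bqf_disc (bqf_act U f) = bqf_disc f.
Proof.
case: f => A B C; have [p [q [r [s hU]]]] := is_mxP U.
rewrite (bqf_actE _ _ _ hU) /bqf_disc /=.
transitivity ((B ^+ 2 - 4 * A * C) * (p * s - q * r) ^+ 2); first by ring.
by rewrite (is_mx_det hU) expr1n mulr1.
Qed.

(** * Words in the letters *)

(** [mod_S] crosses the (x)-vertex; [mod_R] or its square then chooses one of the two other edges at
    the *-vertex reached. *)
Definition letter (b : bool) : PSL2Z :=
  if b then (mod_S * mod_R * mod_R)%g else (mod_S * mod_R)%g.

Fixpoint word (w : seq bool) : PSL2Z :=
  if w is b :: w' then (letter b * word w')%g else 1%g.

Lemma is_mx_letter b : is_mx (letter b) 1 (- b%:Z) (- (~~ b)%:Z) 1.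
Proof.
have hSR := is_mx_mul is_mx_S is_mx_R.
case: b => /=.
  by have := is_mx_opp (is_mx_mul hSR is_mx_R); congr is_mx.
by have := is_mx_opp hSR; congr is_mx.
Qed.

Lemma word_cat u v : word (u ++ v) = (word u * word v)%g.
Proof. by elim: u => [|b u IHu] /=; rewrite ?mul1g // IHu mulgA. Qed.

Lemma word_rcons u b : word (rcons u b) = (word u * letter b)%g.
Proof. by rewrite -cats1 word_cat /= mulg1. Qed.

Lemma is_mx_word w : exists p q r s,
  [/\ is_mx (word w) p (- q) (- r) s, 0 < p, 0 <= q, 0 <= r & 0 < s].
Proof.
elim: w => [|b w [p [q [r [s [hw p0 q0 r0 s0]]]]]] /=.
  by exists 1, 0, 0, 1; split => //; exact: is_mx_one.
have := is_mx_mul (is_mx_letter b) hw; case: b => /= h.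
  by exists (p + r), (q + s), r, s; split; [move: h; congr is_mx; ring|lia..].
by exists p, q, (p + r), (q + s); split; [move: h; congr is_mx; ring|lia..].
Qed.

Lemma word_neq1 b w : word (b :: w) <> 1%g.
Proof.
move=> /= h; have [p [q [r [s [hw p0 q0 r0 s0]]]]] := is_mx_word w.
have := is_mx_mul (is_mx_letter b) hw; rewrite h => /is_mx_inj /(_ is_mx_one).
by case: b h => /= _ [] []; lia.
Qed.

(** The first letter can be read off: in absolute value, the first column strictly decreases
    downwards after [letter true] and does not after [letter false]. *)
Lemma word_inj : injective word.
Proof.
elim=> [|a u IHu] [|b v] //; [by move=> /esym/word_neq1|by move=> /word_neq1|].
case: (eqVneq a b) => [->|neq] /= h; first by rewrite (IHu v (mulgI _ _ _ h)).
exfalso.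
have [p [q [r [s [hu p0 q0 r0 s0]]]]] := is_mx_word u.
have [p' [q' [r' [s' [hv p0' q0' r0' s0']]]]] := is_mx_word v.
have := is_mx_mul (is_mx_letter a) hu; rewrite h.
move=> /is_mx_inj /(_ (is_mx_mul (is_mx_letter b) hv)).
by case: a b neq {h} => -[] //= _ [] []; lia.
Qed.

(** Euclidean descent on the sum of the entries: when one row dominates the other, the corresponding
    letter can be split off on the left. *)
Lemma nonneg_word U p q r s : is_mx U p (- q) (- r) s ->
  0 <= p -> 0 <= q -> 0 <= r -> 0 <= s -> exists w, U = word w.
Proof.
have [n] := ubnP `|(p + q + r + s)%R|%N; elim: n U p q r s => // n IHn U p q r s lt hU.
have d := is_mx_det hU.
move=> p0 q0 r0 s0.
have rs : 0 < r + s by nia.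
have pq : 0 < p + q by nia.
have [/andP[h1 h2]|h1] := boolP ((r <= p) && (s <= q)).
  have hV : is_mx ((letter true)^-1 * U)%g (p - r) (- (q - s)) (- r) s.
    by have := is_mx_mul (is_mx_inv (is_mx_letter true)) hU; congr is_mx; lia.
  have [w hw] : exists w, ((letter true)^-1 * U)%g = word w.
    by apply: (IHn _ _ _ _ _ _ hV); lia.
  by exists (true :: w); rewrite /= -hw mulVKg.
have [/andP[h2 h3]|h2] := boolP ((p <= r) && (q <= s)).
  have hV : is_mx ((letter false)^-1 * U)%g p (- q) (- (r - p)) (s - q).
    by have := is_mx_mul (is_mx_inv (is_mx_letter false)) hU; congr is_mx; lia.
  have [w hw] : exists w, ((letter false)^-1 * U)%g = word w.
    by apply: (IHn _ _ _ _ _ _ hV); lia.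
  by exists (false :: w); rewrite /= -hw mulVKg.
(* Neither row dominates: the first case makes the determinant negative, the second gives
   [p * s - q * r >= 1 + q + r]. *)
have [[h3 h4]|[h3 h4]] : (p < r /\ s < q) \/ (r < p /\ q < s) by lia.
  by exfalso; nia.
have [q1 r1] : q = 0 /\ r = 0 by nia.
have [p1 s1] : p = 1 /\ s = 1 by subst; nia.
by exists [::]; apply: is_mx_uniq hU _; subst; exact: is_mx_one.
Qed.

Local Ltac pick := first [by apply: Or41; split; lia | by apply: Or42; split; lia
  | by apply: Or43; split; lia | by apply: Or44; split; lia].

(** Since [p * s] and [q * r] differ by 1, they never have strictly opposite signs, which leaves
    four patterns up to a common sign. In order, these are the words, the inverses of words, [mod_S]
    times such an inverse, and such an inverse times [mod_S]. *)
Lemma PSL2Z_sign U : exists a b c d,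
  [/\ 0 <= a, 0 <= b, 0 <= c & 0 <= d] /\
  [\/ is_mx U a (- b) (- c) d, is_mx U a b c d,
      is_mx U a b (- c) (- d) | is_mx U a (- b) c (- d)].
Proof.
have [p [q [r [s hU]]]] := is_mxP U.
have d := is_mx_det hU; have hN := is_mx_opp hU.
exists `|p|, `|q|, `|r|, `|s|; split => //.
have solve x y z t : is_mx U x y z t ->
    [\/ [/\ x = `|p|, y = - `|q|, z = - `|r| & t = `|s|],
        [/\ x = `|p|, y = `|q|, z = `|r| & t = `|s|],
        [/\ x = `|p|, y = `|q|, z = - `|r| & t = - `|s|] |
        [/\ x = `|p|, y = - `|q|, z = `|r| & t = - `|s|]] ->
    [\/ is_mx U `|p| (- `|q|) (- `|r|) `|s|, is_mx U `|p| `|q| `|r| `|s|,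
        is_mx U `|p| `|q| (- `|r|) (- `|s|) | is_mx U `|p| (- `|q|) `|r| (- `|s|)].
  by move=> h [][<- <- <- <-]; [apply: Or41|apply: Or42|apply: Or43|apply: Or44].
have : (0 <= p * s /\ 0 <= q * r) \/ (p * s <= 0 /\ q * r <= 0) by nia.
move=> [[ps qr]|[ps qr]].
  have [|] : (0 <= p /\ 0 <= s) \/ (p <= 0 /\ s <= 0) by nia.
    have [|] : (0 <= q /\ 0 <= r) \/ (q <= 0 /\ r <= 0) by nia.
      by move=> ? ?; apply: (solve _ _ _ _ hU); pick.
    by move=> ? ?; apply: (solve _ _ _ _ hU); pick.
  have [|] : (0 <= q /\ 0 <= r) \/ (q <= 0 /\ r <= 0) by nia.
    by move=> ? ?; apply: (solve _ _ _ _ hN); pick.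
  by move=> ? ?; apply: (solve _ _ _ _ hN); pick.
have [|] : (0 <= p /\ s <= 0) \/ (p <= 0 /\ 0 <= s) by nia.
  have [|] : (0 <= q /\ r <= 0) \/ (q <= 0 /\ 0 <= r) by nia.
    by move=> ? ?; apply: (solve _ _ _ _ hU); pick.
  by move=> ? ?; apply: (solve _ _ _ _ hU); pick.
have [|] : (0 <= q /\ r <= 0) \/ (q <= 0 /\ 0 <= r) by nia.
  by move=> ? ?; apply: (solve _ _ _ _ hN); pick.
by move=> ? ?; apply: (solve _ _ _ _ hN); pick.
Qed.

(** That is, [mod_S] and [mod_R] generate the group. The admissible factors are closed under
    products and contain the letters and their inverses, and [PSL2Z_sign] reduces every element to
    these. *)
Lemma PSL2Z_ind (Q : PSL2Z -> Prop) :
  (forall X, Q X -> Q (X * mod_S)%g) -> (forall X, Q X -> Q (X * mod_R)%g) ->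
  forall X W, Q X -> Q (X * W)%g.
Proof.
move=> QS QR; pose good (W : PSL2Z) := forall X, Q X -> Q (X * W)%g.
have goodM V W : good V -> good W -> good (V * W)%g.
  by move=> hV hW X /hV/hW; rewrite mulgA.
have hS : good mod_S by move=> X; exact: QS.
have hR : good mod_R by move=> X; exact: QR.
have good_letter b : good (letter b).
  by case: b; [exact: goodM (goodM _ _ hS hR) hR|exact: goodM hS hR].
have good_letterV b : good (letter b)^-1%g.
  have RV : (mod_R^-1 = mod_R * mod_R)%g.
    by rewrite -[RHS]mul1g -(mulVg mod_R) -!mulgA [X in (_ * X)%g]mulgA mod_RRR mulg1.
  have SV : (mod_S^-1 = mod_S)%g.
    by rewrite -[RHS]mul1g -(mulVg mod_S) -!mulgA mod_SS mulg1.
  have hRR := goodM _ _ hR hR.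
  case: b; rewrite /letter !invgM SV RV; last exact: goodM.
  by apply: (goodM _ _ hRR); exact: goodM.
have good1 : good 1%g by move=> X; rewrite mulg1.
have good_word w : good (word w) by elim: w => [|b w IHw] //=; apply: goodM.
have good_wordV w : good (word w)^-1%g.
  by elim: w => [|b w IHw] /=; rewrite ?invg1 // invgM; apply: goodM.
have good_pos V a b c d : is_mx V a b c d ->
    [/\ 0 <= a, 0 <= b, 0 <= c & 0 <= d] -> good V.
  move=> hV [a0 b0 c0 d0]; rewrite -[V]invgK.
  by have [w ->] := nonneg_word (is_mx_inv hV) d0 b0 c0 a0.
have goodS V : good (V * mod_S)%g -> good V.
  by move=> h; rewrite -[V]mulg1 -mod_SS mulgA; apply: goodM.
have goodS' V : good (mod_S * V)%g -> good V.
  by move=> h; rewrite -[V]mul1g -mod_SS -mulgA; apply: goodM.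
suff all_good W : good W by move=> X W; exact: all_good.
have [a [b [c [d [[a0 b0 c0 d0] []hW]]]]] := PSL2Z_sign W.
- by have [w ->] := nonneg_word hW a0 b0 c0 d0.
- exact: good_pos hW _.
- apply: goodS'; have := is_mx_mul is_mx_S hW => hSW.
  apply: (@good_pos _ c d a b) => //.
  by move: hSW; congr is_mx; ring.
- apply: goodS; have := is_mx_opp (is_mx_mul hW is_mx_S) => hWS.
  apply: (@good_pos _ b a d c) => //.
  by move: hWS; congr is_mx; ring.
Qed.

(** * Reduced forms *)

Definition reduced (f : bqf) : Prop := bqA f < 0 < bqC f.

(* c (b, d) = d (a, c) + (1, 0), and the form is negative at (1, 0). *)
Lemma reduced_convex (A B C a b c d : int) : A < 0 < C ->
  0 <= a -> 0 <= b -> 0 <= c -> 0 <= d -> b * c - a * d = 1 ->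
  A * a ^+ 2 + B * a * c + C * c ^+ 2 < 0 ->
  A * b ^+ 2 + B * b * d + C * d ^+ 2 < 0.
Proof.
move=> /andP[A0 C0] a0 b0 c0 d0 det f1.
have c1 : 0 < c by nia.
have h1 : a * (A * a + B * c) < 0 by nia.
have h2 : A * a + B * c < 0 by nia.
have h3 : 2 * A * a + B * c < 0 by nia.
suff : c ^+ 2 * (A * b ^+ 2 + B * b * d + C * d ^+ 2) < 0.
  by rewrite pmulr_rlt0 ?exprn_gt0.
have -> : c ^+ 2 * (A * b ^+ 2 + B * b * d + C * d ^+ 2) =
    d ^+ 2 * (A * a ^+ 2 + B * a * c + C * c ^+ 2) + d * (2 * A * a + B * c) + A.
  have e : b * c = 1 + a * d by rewrite -det; ring.
  transitivity (A * (b * c) ^+ 2 + B * (b * c) * (c * d) + C * c ^+ 2 * d ^+ 2).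
    by ring.
  by rewrite e; ring.
nia.
Qed.

(** In the last two patterns of [PSL2Z_sign] one has [b * c - a * d = 1]; there [reduced_convex]
    shows that a negative first coefficient forces a negative last one. *)
Lemma reduced_word f V : reduced f -> reduced (bqf_act V f) ->
  exists v, V = word v \/ V^-1%g = word v.
Proof.
case: f => A B C red; have /andP/=[A0 C0] := red.
have [a [b [c [d [[a0 b0 c0 d0] []hV]]]]] := PSL2Z_sign V.
- by have [w ->] := nonneg_word hV a0 b0 c0 d0; exists w; left.
- by have [w hw] := nonneg_word (is_mx_inv hV) d0 b0 c0 a0; exists w; right.
- have det := is_mx_det hV; rewrite (bqf_actE _ _ _ hV) => /andP/=[h1 h2].
  have := @reduced_convex A (- B) C a b c d red a0 b0 c0 d0; nia.
- have det := is_mx_det hV; rewrite (bqf_actE _ _ _ hV) => /andP/=[h1 h2].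
  have := @reduced_convex A B C a b c d red a0 b0 c0 d0; nia.
Qed.

(** * Primitive forms and the form of a hyperbolic element *)

Lemma bqf_dvd_act d f V : (d %| bqA f)%Z -> (d %| bqB f)%Z -> (d %| bqC f)%Z ->
  [/\ (d %| bqA (bqf_act V f))%Z, (d %| bqB (bqf_act V f))%Z &
      (d %| bqC (bqf_act V f))%Z].
Proof.
case: f => A B C; have [p [q [r [s hV]]]] := is_mxP V.
rewrite (bqf_actE _ _ _ hV) /= => /dvdzP[a ->] /dvdzP[b ->] /dvdzP[c ->].
split; apply/dvdzP.
- by exists (a * p ^+ 2 + b * p * r + c * r ^+ 2); ring.
- by exists (2 * a * p * q + b * (p * s + q * r) + 2 * c * r * s); ring.
- by exists (a * q ^+ 2 + b * q * s + c * s ^+ 2); ring.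
Qed.

Lemma bqf_primitiveP f : bqf_primitive f <->
  forall d, (d %| bqA f)%Z -> (d %| bqB f)%Z -> (d %| bqC f)%Z -> (d %| 1%R)%Z.
Proof.
rewrite /bqf_primitive; split => [h d dA dB dC|h].
  by rewrite -h !dvdz_gcd dA dB dC.
have := h (gcdz (gcdz (bqA f) (bqB f)) (bqC f)).
rewrite dvdz_gcdr (dvdz_trans (dvdz_gcdl _ _) (dvdz_gcdl _ _)).
rewrite (dvdz_trans (dvdz_gcdl _ _) (dvdz_gcdr _ _)) => /(_ isT isT isT).
by rewrite dvdz1 /gcdz absz_nat => /eqP ->.
Qed.

Lemma bqf_primitive_act f V : bqf_primitive f -> bqf_primitive (bqf_act V f).
Proof.
move=> /bqf_primitiveP h; apply/bqf_primitiveP => d dA dB dC.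
have := bqf_dvd_act V^-1%g dA dB dC; rewrite -bqf_actM mulgV bqf_act1.
by case; exact: h.
Qed.

Lemma hyperbolic_mx M : hyperbolic M -> exists p q r s, is_mx M p q r s /\ 2 < p + s.
Proof.
have [p [q [r [s hM]]]] := is_mxP M; rewrite (hyperbolicE hM) => h.
have [t0|t0] := lerP 0 (p + s); first by exists p, q, r, s; split => //; lia.
exists (- p), (- q), (- r), (- s); split; [exact: is_mx_opp|lia].
Qed.

Lemma form_of_spec M p q r s : is_mx M p q r s -> 2 < p + s ->
  bqf_primitive (form_of M) /\ exists2 g, 0 < g &
  [/\ r = g * bqA (form_of M), s - p = g * bqB (form_of M) &
      - q = g * bqC (form_of M)].
Proof.
move=> hM t2; have det := is_mx_det hM.
rewrite (form_ofE hM) gtr0_sg ?(lt_trans _ t2) //=; set g := gcdz _ r.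
rewrite !mul1r.
have gq : (g %| q)%Z by apply: dvdz_trans (dvdz_gcdl _ _); exact: dvdz_gcdl.
have gB : (g %| s - p)%Z by apply: dvdz_trans (dvdz_gcdl _ _) (dvdz_gcdr _ _).
have gr : (g %| r)%Z by exact: dvdz_gcdr.
have g0 : 0 < g.
  (* If [g] vanished, so would [q], [r] and [s - p], and the trace would have square 4. *)
  rewrite lt_neqAle /gcdz lez_nat leq0n andbT eq_sym -/g -/(gcdz _ _) -/g.
  apply/negP => /eqP e; move: gq gB gr; rewrite e !dvd0z => /eqP q0 /eqP B0 /eqP r0.
  have : (p + s) ^+ 2 = 4 by nia.
  by nia.
have gN0 : g != 0 by rewrite gt_eqF.
case/dvdzP: gq (erefl g) => a aE; case/dvdzP: gB => b bE; case/dvdzP: gr => c cE.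
rewrite {1}/g aE bE cE -mulNr !mulzK // => gE.
split; last by exists g => //; split; rewrite /= mulrC.
apply/bqf_primitiveP => d /= dA dB dC.
have : (g * d %| g * 1)%Z.
  rewrite mulr1 -[X in (_ %| X)%Z]gE !dvdz_gcd ![_ * g]mulrC !dvdz_mul2l // dA dB.
  by rewrite -[a]opprK rpredN dC.
by rewrite dvdz_mul2l.
Qed.

(** Identifies the form without computing a gcd: if positive multiples of two primitive forms agree,
    the two factors divide each other. *)
Lemma form_of_uniq M p q r s f g : is_mx M p q r s -> 2 < p + s ->
  bqf_primitive f -> 0 < g -> r = g * bqA f -> s - p = g * bqB f ->
  - q = g * bqC f -> form_of M = f.
Proof.
move=> hM t2 fp g0 rE BE qE; have [fM [h h0 [rE' BE' qE']]] := form_of_spec hM t2.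
have dv (F G : bqf) (x y : int) : 0 < x -> 0 < y -> bqf_primitive F ->
    x * bqA F = y * bqA G -> x * bqB F = y * bqB G -> x * bqC F = y * bqC G ->
    (y %| x)%Z.
  move=> x0 y0 Fp hA hB hC.
  have hx : gcdz (gcdz (x * bqA F) (x * bqB F)) (x * bqC F) = x.
    move: Fp; rewrite /bqf_primitive -mulz_gcdr gtz0_abs // -mulz_gcdr gtz0_abs //.
    by move=> ->; rewrite mulr1.
  by rewrite -hx !dvdz_gcd hA hB hC !dvdz_mulr.
have gh : g = h.
  have hg : (h %| g)%Z 
    by apply: (dv _ (form_of M) _ _ g0 h0 fp); rewrite -?rE -?rE' -?BE -?BE' -?qE -?qE'.
  have gh : (g %| h)%Z 
    by apply: (dv _ f _ _ h0 g0 fM); rewrite -?rE -?rE' -?BE -?BE' -?qE -?qE'.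
  case/dvdzP: hg => x hx; case/dvdzP: gh => y hy.
  have x0 : 0 < x by rewrite -(pmulr_lgt0 _ h0) -hx.
  have y0 : 0 < y by rewrite -(pmulr_lgt0 _ g0) -hy.
  by nia.
have g1 : g != 0 by rewrite gt_eqF.
move: rE' BE' qE'; rewrite rE BE qE -gh => /(mulfI g1) hA /(mulfI g1) hB /(mulfI g1) hC.
by case: f (form_of M) hA hB hC {fp fM dv rE BE qE} => A B C [A' B' C'] /= -> -> ->.
Qed.

Lemma form_of_prim M : hyperbolic M -> bqf_primitive (form_of M).
Proof. by case/hyperbolic_mx => p [q [r [s [hM /(form_of_spec hM)[]]]]]. Qed.

(** The triple (r, s - p, -q) is transformed by [V] as a quadratic form, with the same factor [g];
    the trace and primitivity are preserved. *)
Lemma form_ofJ M V : hyperbolic M ->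
  hyperbolic (M ^ V)%g /\ form_of (M ^ V)%g = bqf_act V (form_of M).
Proof.
case/hyperbolic_mx => p [q [r [s [hM t2]]]].
have [fp [g g0 [rE BE qE]]] := form_of_spec hM t2.
have [a [b [c [d hV]]]] := is_mxP V; have det := is_mx_det hV.
have hJ := is_mx_mul (is_mx_inv hV) (is_mx_mul hM hV).
have tE : (d * (p * a + q * c) + - b * (r * a + s * c)) +
    (- c * (p * b + q * d) + a * (r * b + s * d)) = p + s.
  by transitivity ((a * d - b * c) * (p + s)); [ring|rewrite det mul1r].
split; first by rewrite (hyperbolicE hJ) tE; lia.
apply: (form_of_uniq hJ _ (bqf_primitive_act V fp) g0); first by rewrite tE.
- case: (form_of M) rE BE qE {fp} => A B C; rewrite (bqf_actE _ _ _ hV) /= => rE BE qE.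
  transitivity (r * a ^+ 2 + (s - p) * a * c + - q * c ^+ 2); first by ring.
  by rewrite rE BE qE; ring.
- case: (form_of M) rE BE qE {fp} => A B C; rewrite (bqf_actE _ _ _ hV) /= => rE BE qE.
  transitivity (2 * r * a * b + (s - p) * (a * d + b * c) + 2 * - q * c * d).
    by ring.
  by rewrite rE BE qE; ring.
- case: (form_of M) rE BE qE {fp} => A B C; rewrite (bqf_actE _ _ _ hV) /= => rE BE qE.
  transitivity (r * b ^+ 2 + (s - p) * b * d + - q * d ^+ 2); first by ring.
  by rewrite rE BE qE; ring.
Qed.

(** For positive trace, A < 0 < C means that [q] and [r] are negative; then [p * s = 1 + q * r] is
    positive, and so are [p] and [s]. In the other direction, a word with a zero off-diagonal entry
    has trace 2. *)
Lemma wordP M : hyperbolic M -> (exists w, M = word w) <-> reduced (form_of M).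
Proof.
move=> hyp; split => [[w hw]|].
  have [p [q [r [s [hM p0 q0 r0 s0]]]]] := is_mx_word w; rewrite -hw in hM.
  have det := is_mx_det hM; move: hyp; rewrite (hyperbolicE hM) => t2.
  have [|_ [g g0 [rE BE qE]]] := form_of_spec hM; first lia.
  have [q1 r1] : 0 < q /\ 0 < r.
    have [qr|qr] : 0 < q * r \/ q * r = 0 by nia.
      by nia.
    have : p * s = 1 by nia.
    by nia.
  by apply/andP; nia.
case/hyperbolic_mx: hyp => p [q [r [s [hM t2]]]].
have det := is_mx_det hM.
have [_ [g g0 [rE BE qE]]] := form_of_spec hM t2.
move=> /andP[A0 C0]; have [q0 r0] : q < 0 /\ r < 0 by nia.
have [p0 s0] : 0 < p /\ 0 < s by nia.
by apply: (@nonneg_word _ p (- q) (- r) s); rewrite ?opprK //; lia.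
Qed.

Definition nonsquare (d : int) : Prop := ~ exists n : int, d = n ^+ 2.

(** With t > 2 the trace and D the discriminant, g^2 D = t^2 - 4 lies strictly between (t - 1)^2 and
    t^2. *)
Lemma form_of_disc M : hyperbolic M ->
  0 < bqf_disc (form_of M) /\ nonsquare (bqf_disc (form_of M)).
Proof.
case/hyperbolic_mx => p [q [r [s [hM t2]]]]; have det := is_mx_det hM.
have [_ [g g0 []]] := form_of_spec hM t2.
case: (form_of M) => A B C /= rE BE qE.
have e : g ^+ 2 * bqf_disc (BQF A B C) = (p + s) ^+ 2 - 4.
  rewrite /bqf_disc /=; transitivity ((s - p) ^+ 2 + 4 * q * r).
    by rewrite -[q]opprK rE BE qE; ring.
  by transitivity ((p + s) ^+ 2 - 4 * (p * s - q * r)); [ring|rewrite det mulr1].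
split; first by nia.
move=> [n hn]; rewrite hn -exprMn in e.
have : `|g * n| < p + s by nia.
by nia.
Qed.

Lemma disc_mod4 f : (bqf_disc f %% 4)%Z = 0 \/ (bqf_disc f %% 4)%Z = 1.
Proof.
case: f => A B C; rewrite /bqf_disc /=.
have [k [hk|hk]] : exists k, B = 2 * k \/ B = 2 * k + 1 by exists (B %/ 2)%Z; lia.
  left; have -> : B ^+ 2 - 4 * A * C = (k ^+ 2 - A * C) * 4 by rewrite hk; ring.
  lia.
right; have -> : B ^+ 2 - 4 * A * C = (k ^+ 2 + k - A * C) * 4 + 1 by rewrite hk; ring.
lia.
Qed.

(** * Reduction of indefinite forms *)

Lemma bqf_act_letter b A B C : bqf_act (letter b) (BQF A B C) =
  if b then BQF A (B - 2 * A) (A - B + C) else BQF (A - B + C) (B - 2 * C) C.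
Proof.
by rewrite (bqf_actE _ _ _ (is_mx_letter b)); case: b => /=; congr BQF; ring.
Qed.

Lemma bqf_act_letterV b A B C : bqf_act (letter b)^-1%g (BQF A B C) =
  if b then BQF A (B + 2 * A) (A + B + C) else BQF (A + B + C) (B + 2 * C) C.
Proof.
rewrite (bqf_actE _ _ _ (is_mx_inv (is_mx_letter b))).
by case: b => /=; congr BQF; ring.
Qed.

Lemma bqf_act_S A B C : bqf_act mod_S (BQF A B C) = BQF C (- B) A.
Proof. by rewrite (bqf_actE _ _ _ is_mx_S); congr BQF; ring. Qed.

Lemma nonsquare_AC A B C : nonsquare (bqf_disc (BQF A B C)) -> A * C <> 0.
Proof. by move=> h AC; apply: h; exists B; rewrite /bqf_disc /=; nia. Qed.

(** Descent on |B|: if A C > 0, positivity of the discriminant gives |B| > 2 min(|A|, |C|), so that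
    a suitable letter or its inverse decreases |B|. If A C < 0, at most [mod_S] is needed. *)
Lemma exists_reduced f : 0 < bqf_disc f -> nonsquare (bqf_disc f) ->
  exists V, reduced (bqf_act V f).
Proof.
have [n] := ubnP `|bqB f|%N; elim: n f => // n IHn [A B C] lt d0 ns.
have AC := nonsquare_AC ns.
have [h|h] := ltrP (A * C) 0.
  have [A0|A0] := ltrP A 0.
    by exists 1%g; rewrite bqf_act1 /reduced /= A0 -(nmulr_rlt0 _ A0).
  have A1 : 0 < A by rewrite lt0r A0 andbT; apply/eqP => e; rewrite e mul0r in AC.
  by exists mod_S; rewrite bqf_act_S /reduced /= A1 -(pmulr_rlt0 _ A1) h.
have step U : (`|bqB (bqf_act U (BQF A B C))| < n)%N ->
    exists V, reduced (bqf_act V (BQF A B C)).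
  move=> lt'.
  have [||V hV] := IHn (bqf_act U (BQF A B C)) lt'; rewrite ?bqf_disc_act //.
  by exists (U * V)%g; rewrite bqf_actM.
move: lt d0; rewrite /bqf_disc /= => lt d0.
have [le|le] := lerP `|A| `|C|.
  have BA : 2 * `|A| < `|B| by nia.
  have [s|s] := lerP 0 (B * A).
    by apply: (step (letter true)); rewrite bqf_act_letter /=; nia.
  by apply: (step (letter true)^-1%g); rewrite bqf_act_letterV /=; nia.
have BC : 2 * `|C| < `|B| by nia.
have [s|s] := lerP 0 (B * C).
  by apply: (step (letter false)); rewrite bqf_act_letter /=; nia.
by apply: (step (letter false)^-1%g); rewrite bqf_act_letterV /=; nia.
Qed.

(** * The axis of a hyperbolic element *)

(** The edge [W] is on the axis of [M], and [M] traverses it towards its (x)-vertex. The edges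
    traversed towards their *-vertex are the [W * mod_S] for such [W]. *)
Definition ax (M W : PSL2Z) : Prop := exists w, (M ^ W)%g = word w.

Lemma axE M W : hyperbolic M -> ax M W <-> reduced (bqf_act W (form_of M)).
Proof. by move=> hM; have [hJ <-] := form_ofJ W hM; rewrite -wordP. Qed.

Lemma ax_exists M : hyperbolic M -> exists W, ax M W.
Proof.
move=> hM; have [d0 ns] := form_of_disc hM.
by have [W hW] := exists_reduced d0 ns; exists W; apply/axE.
Qed.

Lemma not_hyperbolic1 : ~ hyperbolic 1%g.
Proof. by rewrite (hyperbolicE is_mx_one). Qed.

Lemma hyperbolicJ M W : hyperbolic M -> hyperbolic (M ^ W)%g.
Proof. by case/(form_ofJ W). Qed.

Lemma ax_word_neq0 M W w : hyperbolic M -> (M ^ W)%g = word w -> w <> [::].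
Proof.
by move=> /(hyperbolicJ W) h e w0; apply: not_hyperbolic1; rewrite e w0 in h.
Qed.

Lemma word_pow w k : word (flatten (nseq k w)) = (word w ^+ k)%g.
Proof. by elim: k => //= k IHk; rewrite word_cat IHk expgS. Qed.

Lemma size_pow T (w : seq T) k : size (flatten (nseq k w)) = (k * size w)%N.
Proof. by elim: k => //= k IHk; rewrite size_cat IHk mulSn. Qed.

Lemma conj_pow (M W : PSL2Z) k : (M ^ (M ^+ k * W) = M ^ W)%g.
Proof.
rewrite conjgM; congr (_ ^ _)%g.
by rewrite conjgE -expgS expgSr mulKg.
Qed.

Lemma ax_pow M W k : ax M (M ^+ k * W)%g <-> ax M W.
Proof. by rewrite /ax conj_pow. Qed.

(** By [reduced_word], [W'] is ahead of [W] or behind it on the axis; if it is behind, a power of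
    [M] brings it ahead. *)
Lemma ax_connected M W w W' : hyperbolic M -> (M ^ W)%g = word w -> ax M W' ->
  exists k v, (M ^+ k * W' = W * word v)%g.
Proof.
move=> hM hw hW'; have w0 := ax_word_neq0 hM hw.
have hW : ax M W by exists w.
have conn X : ax M X -> exists v, (W^-1 * X)%g = word v \/ (W^-1 * X)^-1%g = word v.
  move=> /(axE _ hM) hX; move/(axE _ hM): hW => red.
  by apply: (reduced_word red); rewrite -bqf_actM mulVKg.
have [v [hv|hv]] := conn W' hW'.
  by exists 0%N, v; rewrite expg0 mul1g -hv mulVKg.
(* [W'] is [size v] letters behind, and each application of [M] advances by at least one letter. *)
exists (size v).+1; set k := (size v).+1.
have [|y [hy|hy]] := conn (M ^+ k * W')%g; first exact/ax_pow.
  by exists y; rewrite -hy mulVKg.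
exfalso; have : v = y ++ flatten (nseq k w).
  apply: word_inj; rewrite word_cat word_pow -hw -hy -hv -conjXg.
  by rewrite !invgM !invgK conjgE !mulgA mulgK mulgVK.
move=> /(congr1 size); rewrite size_cat size_pow /k.
by case: w w0 {hw} => // a w _ /=; lia.
Qed.

(** The axis continues in only one way: in [w ++ a :: v = (a :: v) ++ w'] the first letters
    agree. *)
Lemma ax_step M W w a v : hyperbolic M -> (M ^ W)%g = word w ->
  ax M (W * word (a :: v))%g -> exists w1, w = a :: w1.
Proof.
move=> hM hw [w']; rewrite conjgM hw => e; have w0 := ax_word_neq0 hM hw.
have : w ++ a :: v = (a :: v) ++ w'.
  by apply: word_inj; rewrite !word_cat -e conjgE mulVKg.
by case: w w0 {hw e} => // b w _ [-> _]; exists w.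
Qed.

Lemma ax_rot M W w a : (M ^ W)%g = word (a :: w) ->
  (M ^ (W * letter a))%g = word (rcons w a).
Proof. by move=> h; rewrite conjgM h word_rcons /= conjgE !mulgA mulVg mul1g. Qed.

Lemma ax_prefix M W u v : (M ^ W)%g = word (u ++ v) ->
  (M ^ (W * word u))%g = word (v ++ u).
Proof. by move=> h; rewrite conjgM h !word_cat conjgE !mulgA mulVg mul1g. Qed.

Lemma hyperbolicV M : hyperbolic M -> hyperbolic M^-1%g.
Proof.
have [p [q [r [s hM]]]] := is_mxP M.
by rewrite (hyperbolicE hM) (hyperbolicE (is_mx_inv hM)) addrC.
Qed.

Lemma form_ofV M : hyperbolic M ->
  form_of M^-1%g = BQF (- bqA (form_of M)) (- bqB (form_of M)) (- bqC (form_of M)).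
Proof.
case/hyperbolic_mx => p [q [r [s [hM t2]]]].
have [fp [g g0 [rE BE qE]]] := form_of_spec hM t2.
apply: (form_of_uniq (is_mx_inv hM) _ _ g0) => /=; first by rewrite addrC.
- apply/bqf_primitiveP => d /=; move/bqf_primitiveP: fp => fp.
  by rewrite !rpredN; exact: fp.
- by rewrite rE mulrN.
- by rewrite mulrN -BE opprB.
- by rewrite mulrN -qE.
Qed.

(** The inverse has the opposite form, and [mod_S] exchanges the outer coefficients: both sides say
    that [bqf_act W (form_of M)] has C < 0 < A. *)
Lemma axV M W : hyperbolic M -> ax M^-1%g W <-> ax M (W * mod_S)%g.
Proof.
move=> hM; rewrite !axE ?form_ofV //; last exact: hyperbolicV.
rewrite bqf_actM; case: (form_of M) => A B C /=.
have [p [q [r [s hW]]]] := is_mxP W.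
rewrite !(bqf_actE _ _ _ hW) bqf_act_S /reduced /=.
lia.
Qed.

Lemma bqf_act_R A B C : bqf_act mod_R (BQF A B C) = BQF (A + B + C) (- (2 * A) - B) A.
Proof. by rewrite (bqf_actE _ _ _ is_mx_R); congr BQF; ring. Qed.

Lemma ax_S M W : hyperbolic M -> ax M W -> ~ ax M (W * mod_S)%g.
Proof.
move=> hM; rewrite !axE // bqf_actM; case: (bqf_act W _) => A B C.
by rewrite bqf_act_S /reduced /=; lia.
Qed.

(** With [ax_RR]: at most one of the three edges at a *-vertex is traversed away from it. *)
Lemma ax_R M W : hyperbolic M -> ax M W -> ~ ax M (W * mod_R)%g.
Proof.
move=> hM; rewrite !axE // bqf_actM; case: (bqf_act W _) => A B C.
by rewrite bqf_act_R /reduced /=; lia.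
Qed.

Lemma ax_RR M W : hyperbolic M -> ax M W -> ~ ax M (W * mod_R * mod_R)%g.
Proof.
move=> hM; rewrite !axE // !bqf_actM; case: (bqf_act W _) => A B C.
by rewrite !bqf_act_R /reduced /=; lia.
Qed.

(** * Roots in the group and roots of words *)

(** [K] commutes with [M], hence preserves its axis, so [K ^ W] is a word or the inverse of one. The
    latter would make the nonempty word [w] cancel against another word. *)
Lemma pow_word M W w K k : hyperbolic M -> (M ^ W)%g = word w -> M = (K ^+ k)%g ->
  exists2 v, (K ^ W)%g = word v & w = flatten (nseq k v).
Proof.
move=> hM hw hK; have w0 := ax_word_neq0 hM hw.
have comm : (M ^ (W * (K ^ W)))%g = (M ^ W)%g.
  have MK : (M ^ K)%g = M by rewrite hK conjXg conjgE mulKg.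
  by rewrite conjgM -conjJg MK.
have red : reduced (bqf_act W (form_of M)) by apply/axE => //; exists w.
have [|v [hv|hv]] := @reduced_word _ (K ^ W)%g red.
- by rewrite -bqf_actM; apply/axE => //; exists w; rewrite comm.
- by exists v => //; apply: word_inj; rewrite word_pow -hv -conjXg -hK.
exfalso; apply: (ax_word_neq0 hM hw).
have /word_inj : word (flatten (nseq k v) ++ w) = word [::].
  by rewrite word_cat word_pow -hv -hw hK conjXg expVgn mulVg.
by case: w {hw w0 comm} => // a w; case: flatten.
Qed.

Definition prim (M : PSL2Z) : Prop := forall K k, (1 < k)%N -> M <> (K ^+ k)%g.

Lemma primP M W w : hyperbolic M -> (M ^ W)%g = word w ->
  prim M <-> ~ proper_power w.
Proof.
move=> hM hw; split=> [pM [u [k [k1 wE]]]|npp K k k1 hK].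
  apply: (pM (word u ^ W^-1)%g k k1).
  by rewrite -conjXg -word_pow -wE -hw conjgK.
by have [v _ wE] := pow_word hM hw hK; apply: npp; exists v, k.
Qed.

(** Euclid's algorithm on lengths: the shorter word is a prefix of the longer one, and what remains
    still commutes with it. *)
Lemma commuting_words (T : eqType) (u v : seq T) : u ++ v = v ++ u ->
  exists z i j, u = flatten (nseq i z) /\ v = flatten (nseq j z).
Proof.
have [n] := ubnP (size u + size v); elim: n u v => // n IHn u v lt e.
wlog le : u v lt e / (size u <= size v)%N.
  move=> h; have [|/ltnW] := leqP (size u) (size v); first exact: h.
  by move=> le; case: (h v u _ _ le) => [||z [i [j [vE uE]]]];
    [rewrite addnC|rewrite e|exists z, j, i].
case: u le lt e => [|a u] le lt e; first by exists v, 0%N, 1%N; rewrite /= cats0.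
have vE : v = (a :: u) ++ drop (size (a :: u)) v.
  rewrite -{1}(cat_take_drop (size (a :: u)) v); congr (_ ++ _).
  have := congr1 (take (size (a :: u))) e.
  by rewrite take_size_cat // takel_cat.
set v' := drop _ _ in vE; move: e; rewrite {1 2}vE -!catA => /eqP.
rewrite eqseq_cat // => /andP[_ /eqP e].
have [|z [i [j [uE v'E]]]] := IHn (a :: u) v' _ e.
  by move: lt; rewrite vE !size_cat /=; lia.
by exists z, i, (i + j)%N; split=> //; rewrite vE uE v'E nseqD flatten_cat.
Qed.

(** * Automorphs *)

(** Both matrices are combinations of the identity and of [0, -C; A, B], where (A, B, C) is the
    common form. *)
Lemma form_of_commute M M' : hyperbolic M -> hyperbolic M' ->
  form_of M = form_of M' -> (M * M' = M' * M)%g.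
Proof.
case/hyperbolic_mx => p [q [r [s [hM t2]]]].
case/hyperbolic_mx => a [b [c [d [hM' t2']]]] e.
have [_ [g g0 [rE BE qE]]] := form_of_spec hM t2.
have [_ [h h0 [cE DE bE]]] := form_of_spec hM' t2'.
move: rE BE qE cE DE bE; rewrite e; case: (form_of M') => A B C /= rE BE qE cE DE bE.
apply: is_mx_uniq (is_mx_mul hM hM') _; move: (is_mx_mul hM' hM).
have -> : q = - (g * C) by rewrite -qE opprK.
have -> : b = - (h * C) by rewrite -bE opprK.
have -> : s = p + g * B by rewrite -BE; ring.
have -> : d = a + h * B by rewrite -DE; ring.
by rewrite rE cE; congr is_mx; ring.
Qed.

(** An edge [W] of one axis also lies on the other; there the two words commute, so they are powers
    of one word, and primitivity makes both exponents 1. *)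
Lemma prim_form_inj M M' : hyperbolic M -> hyperbolic M' -> prim M -> prim M' ->
  form_of M = form_of M' -> M = M'.
Proof.
move=> hM hM' pM pM' e; have [W hW] := ax_exists hM.
have [w' hw'] : ax M' W by apply/axE => //; rewrite -e; exact/axE.
case: hW => w hw.
have [|z [i [j [wE w'E]]]] := @commuting_words _ w w'.
  by apply: word_inj; rewrite !word_cat -hw -hw' -!conjMg (form_of_commute hM hM' e).
have w0 := ax_word_neq0 hM hw; have w0' := ax_word_neq0 hM' hw'.
move/(primP hM hw): pM => pM; move/(primP hM' hw'): pM' => pM'.
have i1 : i = 1%N.
  case: i wE => [|[|i]] // wE; case: pM; by exists z, i.+2.
have j1 : j = 1%N.
  case: j w'E => [|[|j]] // w'E; case: pM'; by exists z, j.+2.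
by apply: (conjg_inj W); rewrite hw hw' wE w'E i1 j1.
Qed.

(** Invariance makes (r, s - p, -q) an integral multiple u (A, B, C), whence t^2 - 4 = u^2 D for the
    trace t. Here u is nonzero because [M] is not the identity, and its sign decides between [M] and
    its inverse. *)
Lemma automorph_form M f : bqf_primitive f -> 0 < bqf_disc f -> bqf_act M f = f ->
  M <> 1%g -> hyperbolic M /\ (form_of M = f \/ form_of M^-1%g = f).
Proof.
case: f => A B C fp d0; have [p [q [r [s hM]]]] := is_mxP M.
have det := is_mx_det hM; rewrite (bqf_actE _ _ _ hM) => -[hA hB hC] M1.
set A' := A * p ^+ 2 + _ + _ in hA; set B' := _ + B * (_ + _) + _ in hB.
set C' := _ + _ + _ in hC.
(* The three relations come from multiplying the invariance of the symmetric matrix of the form by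
   the adjugate of [M]. *)
have e1 : A * (s - p) = B * r.
  have : (2 * A * p + B * r) * (p * s - q * r) = 2 * s * A' - r * B'.
    by rewrite /A' /B'; ring.
  by rewrite det hA hB; lia.
have e2 : A * - q = C * r.
  have : (2 * A * q + B * s) * (p * s - q * r) = s * B' - 2 * r * C'.
    by rewrite /B' /C'; ring.
  by rewrite det hB hC; lia.
have e3 : C * (s - p) = B * - q.
  have : (B * q + 2 * C * s) * (p * s - q * r) = 2 * p * C' - q * B'.
    by rewrite /B' /C'; ring.
  by rewrite det hB hC; lia.
have [x [y [z bez]]] : exists x y z, x * A + y * B + z * C = 1.
  have [m [n hmn]] := Bezoutz A B.
  have [k [l hkl]] := Bezoutz (gcdz A B) C.
  exists (k * m), (k * n), l; rewrite -fp -hkl /= -hmn; ring.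
(* The Bezout combination equal to 1 on (A, B, C) extracts the factor of proportionality. *)
pose u := x * r + y * (s - p) + z * - q.
have uA : r = u * A.
  transitivity (r * (x * A + y * B + z * C)); first by rewrite bez mulr1.
  transitivity (x * r * A + y * (B * r) + z * (C * r)); first by ring.
  by rewrite -e1 -e2 /u; ring.
have uB : s - p = u * B.
  transitivity ((s - p) * (x * A + y * B + z * C)); first by rewrite bez mulr1.
  transitivity (x * (A * (s - p)) + y * (s - p) * B + z * (C * (s - p))); first by ring.
  by rewrite e1 e3 /u; ring.
have uC : - q = u * C.
  transitivity (- q * (x * A + y * B + z * C)); first by rewrite bez mulr1.
  transitivity (x * (A * - q) + y * (B * - q) + z * - q * C); first by ring.
  by rewrite e2 -e3 /u; ring.
have tr : (p + s) ^+ 2 - 4 = u ^+ 2 * bqf_disc (BQF A B C).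
  rewrite /bqf_disc /=; transitivity ((s - p) ^+ 2 - 4 * r * - q); last first.
    by rewrite uA uB uC; ring.
  by transitivity ((p + s) ^+ 2 - 4 * (p * s - q * r)); [rewrite det|]; ring.
have u0 : u != 0.
  apply/eqP => u0; apply: M1; move: uA uB uC; rewrite u0 !mul0r => r0 sp q0.
  have {}q0 : q = 0 by rewrite -[q]opprK q0 oppr0.
  have ps : s = p by lia.
  have [p1|p1] : p = 1 \/ p = -1 by move: det; rewrite q0 ps; nia.
    by apply: is_mx_uniq is_mx_one; move: hM; rewrite r0 q0 ps p1.
  by apply: is_mx_uniq is_mx_one; move: (is_mx_opp hM); rewrite r0 q0 ps p1.
have u2 : 0 < u ^+ 2 by rewrite exprn_even_gt0.
have t4 : 4 < (p + s) ^+ 2 by rewrite -subr_gt0 tr mulr_gt0.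
have abs4 (t : int) : 4 < t ^+ 2 -> 2 < `|t| by clear; nia.
split; first by rewrite (hyperbolicE hM) abs4.
clear e1 e2 e3 hA hB hC A' B' C' tr u2 det.
move: (u) u0 uA uB uC => {}u u0 uA uB uC.
wlog t0 : p q r s u u0 hM uA uB uC t4 / 0 < p + s.
  move=> h; have [t0|t0] := ltrP 0 (p + s); first exact: (h p q r s u).
  apply: (h _ _ _ _ (- u) _ (is_mx_opp hM)).
  - by rewrite oppr_eq0.
  - by rewrite uA mulNr.
  - by rewrite mulNr -uB; ring.
  - by rewrite uC mulNr.
  - by rewrite -opprD sqrrN.
  - by have := abs4 _ t4; lia.
have t2 : 2 < p + s by rewrite -[p + s]gtr0_norm // abs4.
have [u1|u1] := ltrP 0 u; first by left; apply: (form_of_uniq hM t2 fp u1).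
right; apply: (@form_of_uniq _ _ _ _ _ _ (- u) (is_mx_inv hM) _ fp) => //=; lia.
Qed.

(** Each letter puts A - B + C in place of one outer coefficient; its sign tells which one keeps the
    form reduced. *)
Definition next_reduced (f : bqf) : bqf :=
  bqf_act (letter (0 < bqA f - bqB f + bqC f)) f.

(** If A - B + C vanished, the discriminant would be (A - C)^2. *)
Lemma next_reducedP f : nonsquare (bqf_disc f) -> reduced f ->
  reduced (next_reduced f).
Proof.
case: f => A B C ns /andP/=[A0 C0]; rewrite /next_reduced /= bqf_act_letter.
case: (ltrgtP 0 (A - B + C)) => h; rewrite /reduced /= ?A0 ?C0 ?h //.
exfalso; apply: ns; exists (A - C); rewrite /bqf_disc /=.
have -> : B = A + C by lia.
ring.
Qed.

Lemma iter_next_reduced n f : exists2 w, size w = n &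
  iter n next_reduced f = bqf_act (word w) f.
Proof.
elim: n => [|n [w sw hw]] /=; first by exists [::]; rewrite ?bqf_act1.
rewrite hw /next_reduced; set b := (0 < _).
by exists (rcons w b); rewrite ?size_rcons ?sw // word_rcons bqf_actM.
Qed.

(** Pigeonhole: the iterates of [next_reduced] repeat, and the letters used between two equal
    iterates form an automorph. *)
Lemma reduced_cycle f : 0 < bqf_disc f -> nonsquare (bqf_disc f) -> reduced f ->
  exists g V w, [/\ g = bqf_act V f, w <> [::] & bqf_act (word w) g = g].
Proof.
move=> d0 ns red; pose F n := iter n next_reduced f.
have FP n : reduced (F n) /\ bqf_disc (F n) = bqf_disc f.
  elim: n => [|n [IH1 IH2]] //=; split; last by rewrite /= bqf_disc_act.
  by apply: next_reducedP; rewrite ?IH2.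
pose N := `|bqf_disc f|%N.
(* The signs of A and C are known, so absolute values suffice for them, while B is shifted by [N] to
   be nonnegative. *)
pose enc (g : bqf) : 'I_(N.*2.+1) * 'I_(N.*2.+1) * 'I_(N.*2.+1) :=
  (inord `|bqA g|%N, inord `|bqC g|%N, inord `|(bqB g + N%:Z)%R|%N).
(* A < 0 < C and B^2 - 4 A C = D bound |A|, |B| and |C| by D. *)
have enc_inj m n : enc (F m) = enc (F n) -> F m = F n.
  have [/andP[Am Cm] dm] := FP m; have [/andP[An Cn] dn] := FP n.
  move: dm dn Am Cm An Cn; rewrite /enc.
  case: (F m) (F n) => A B C [A' B' C']; rewrite /bqf_disc /= => dm dn Am Cm An Cn.
  have bound (a b c : int) : b ^+ 2 - 4 * a * c = bqf_disc f -> a < 0 -> 0 < c ->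
      [/\ (`|a| < N.*2.+1)%N, (`|c| < N.*2.+1)%N, (`|(b + N%:Z)%R| < N.*2.+1)%N &
          0 <= b + N%:Z].
    move=> e a0 c0; have NE : bqf_disc f = N%:Z by rewrite gez0_abs // ltW.
    rewrite NE in e.
    have : - a <= - a * c by rewrite ler_peMr //; lia.
    have : c <= - a * c by rewrite ler_peMl //; lia.
    have : `|b| <= b ^+ 2 by clear; nia.
    by split; lia.
  have [h1 h2 h3 h4] := bound _ _ _ dm Am Cm.
  have [h1' h2' h3' h4'] := bound _ _ _ dn An Cn.
  case=> /(congr1 val) /= + /(congr1 val) /= + /(congr1 val) /=.
  rewrite !inordK // => e1 e2 e3.
  by congr BQF; lia.
pose T : finType := ('I_(N.*2.+1) * 'I_(N.*2.+1) * 'I_(N.*2.+1))%type.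
have /injectivePn[i [j nij eij]] : ~~ injectiveb (fun i : 'I_#|T|.+1 => enc (F i)).
  apply/injectiveP => /leq_card; rewrite card_ord.
  by rewrite ltnn.
wlog lt : i j nij eij / (i < j)%N.
  move=> h; have [lt|lt|e] := ltngtP i j; first exact: (h i j).
    by apply: (h j i) => //; rewrite eq_sym.
  by case/negP: nij; apply/eqP/val_inj.
have e := enc_inj _ _ eij.
have [u _ hu] := iter_next_reduced i f.
have [w sw hw] := iter_next_reduced (j - i) (F i).
exists (F i), (word u), w; split => //.
  by move=> w0; move: sw lt; rewrite w0 /= => /esym/eqP; rewrite subn_eq0 ltnNge => ->.
by rewrite -hw -iterD subnK ?e // ltnW.
Qed.

Lemma primitive_root_word (w : seq bool) : w <> [::] ->
  exists z k, w = flatten (nseq k z) /\ ~ proper_power z.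
Proof.
have [n] := ubnP (size w); elim: n w => // n IHn w lt w0.
have [[u [k [k1 wE]]]|np] := pselect (proper_power w); last first.
  by exists w, 1%N; rewrite /= cats0.
have u0 : u <> [::].
  by move=> u0; apply: w0; apply: size0nil; rewrite wE size_pow u0 muln0.
have [|z [l [uE np]]] := IHn u _ u0.
  move: lt; rewrite wE size_pow; have : (0 < size u)%N by case: (u) u0.
  by nia.
exists z, (k * l)%N; split=> //; apply: word_inj.
by rewrite wE uE !word_pow -expgnA mulnC.
Qed.

(** A word fixing a form equivalent to [f] is conjugated back to an automorph [M] of [f], inverted
    if necessary. Its primitive root [K] then has the form [f] too. *)
Lemma exists_form f : bqf_primitive f -> 0 < bqf_disc f -> nonsquare (bqf_disc f) ->
  exists M, [/\ hyperbolic M, prim M & form_of M = f].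
Proof.
move=> fp d0 ns.
have [M [hM fM]] : exists M, hyperbolic M /\ form_of M = f.
  have [V redV] := exists_reduced d0 ns.
  have [||g [U [w [gE w0 hw]]]] := reduced_cycle _ _ redV; rewrite ?bqf_disc_act //.
  have [X gX] : exists X, g = bqf_act X f by exists (V * U)%g; rewrite bqf_actM.
  have [||hM [fM|fM]] := @automorph_form (word w ^ X^-1)%g f fp d0.
  - by rewrite conjgE invgK !bqf_actM -gX hw gX -bqf_actM mulgV bqf_act1.
  - move=> e; case: w w0 e {hw} => // b w _ e; apply: (@word_neq1 b w).
    by rewrite -[LHS](conjgKV X) e conj1g.
  - by exists (word w ^ X^-1)%g.
  - by exists (word w ^ X^-1)^-1%g; split => //; exact: hyperbolicV.
have [W hW] := ax_exists hM; have [w hw] := hW.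
have w0 := ax_word_neq0 hM hw.
have [z [k [wE np]]] := primitive_root_word w0.
pose K := (word z ^ W^-1)%g.
have KW : (K ^ W)%g = word z by rewrite conjgKV.
have MK : M = (K ^+ k)%g by apply: (conjg_inj W); rewrite hw conjXg KW -word_pow wE.
have [||hK [fK|fK]] := @automorph_form K f fp d0.
- rewrite -fM; have [_ <-] := form_ofJ K hM.
  by rewrite MK conjXg conjgE mulKg.
- by move=> K1; apply: not_hyperbolic1; move: hM; rewrite MK K1 expg1n.
- exists K; split => //; exact/(primP hK KW).
(* [K ^ W] is a word, so [K] translates the axis in the same direction as [M]; the opposite form
   would reverse it. *)
- exfalso; apply: (ax_S hK (W := W)); first by exists z.
  apply/(axV _ hK)/axE; first exact: hyperbolicV.
  by rewrite fK -fM; apply/axE.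
Qed.

(** * Lines in the Farey tree *)

Lemma mod_S_neq1 : mod_S <> 1%g.
Proof. by move=> h; have := is_mx_S; rewrite h => /is_mx_inj /(_ is_mx_one) [] []. Qed.

Lemma mod_R_neq1 : mod_R <> 1%g.
Proof. by move=> h; have := is_mx_R; rewrite h => /is_mx_inj /(_ is_mx_one) [] []. Qed.

Lemma mod_S_neq_R : mod_S <> mod_R.
Proof. by move=> h; have := is_mx_S; rewrite h => /is_mx_inj /(_ is_mx_R) [] []. Qed.

Lemma mulg_neq (X Y : PSL2Z) : Y <> 1%g -> X <> (X * Y)%g.
Proof. by move=> Y1 /(canLR (mulKg X)); rewrite mulVg => /esym. Qed.

Lemma mod_RR_neq1 : (mod_R * mod_R)%g <> 1%g.
Proof. by move=> h; apply: mod_R_neq1; rewrite -mod_RRR h mul1g. Qed.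

Lemma mod_S_neq_RR : mod_S <> (mod_R * mod_R)%g.
Proof.
move=> h; have := is_mx_S; rewrite h => /is_mx_inj.
by move=> /(_ _ _ _ _ (is_mx_mul is_mx_R is_mx_R)) [] [].
Qed.

Lemma farey_oend_eq W W' : farey_oend W = farey_oend W' -> W' = W \/ W' = (W * mod_S)%g.
Proof.
move=> /(congr1 val) /= h; have : overt_set W' W' by left.
by rewrite -h => -[->|->]; [left|right].
Qed.

Lemma farey_bend_eq W W' : farey_bend W = farey_bend W' ->
  [\/ W' = W, W' = (W * mod_R)%g | W' = (W * mod_R * mod_R)%g].
Proof.
move=> /(congr1 val) /= h; have : bvert_set W' W' by left; left.
by rewrite -h => -[[->|->]|->]; [apply: Or31|apply: Or32|apply: Or33].
Qed.

Lemma line_step (l : int -> PSL2Z) k : @is_line farey l ->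
  l (2 * k + 1)%R = (l (2 * k)%R * mod_S)%g /\
  exists b, l (2 * (k + 1))%R = (l (2 * k)%R * letter b)%g.
Proof.
move=> /(_ k) [n1 o n2 b]; have e : l (2 * k + 1)%R = (l (2 * k)%R * mod_S)%g.
  by case: (farey_oend_eq o) => // e; case: n1.
split => //; rewrite mulrDr mulr1.
case: (farey_bend_eq b) => e'; first by case: n2.
  by exists false; rewrite e' e mulgA.
by exists true; rewrite e' e !mulgA.
Qed.

Lemma line_word (l : int -> PSL2Z) k j : @is_line farey l ->
  exists w, l (2 * (k + j%:Z))%R = (l (2 * k)%R * word w)%g.
Proof.
move=> hl; elim: j => [|j [w hw]]; first by exists [::]; rewrite addr0 mulg1.
have [_ [b hb]] := line_step (k + j%:Z) hl.
exists (rcons w b); rewrite word_rcons mulgA -hw -hb.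
by congr (l (2 * _)%R); lia.
Qed.

Lemma axis_line_ax M (l : int -> PSL2Z) : axis_line M l -> forall k,
  ax M (l (2 * k)%R) /\ l (2 * k + 1)%R = (l (2 * k)%R * mod_S)%g.
Proof.
move=> [hl [n n0 hM]] k; split; last by case: (line_step k hl).
have [m nE] : exists m, n = m.*2 \/ n = m.*2.+1.
  by exists n./2; rewrite -{1 3}(odd_double_half n); case: odd; [right|left].
case: nE => nE; rewrite {}nE {n n0} in hM.
  have [w hw] := line_word k m hl; exists w.
  have -> : (M ^ l (2 * k)%R = (l (2 * k)%R)^-1 * farey_act M (l (2 * k)%R))%g by [].
  rewrite hM; have -> : 2 * k + m.*2%:Z = 2 * (k + m%:Z) by lia.
  by rewrite hw mulKg.
(* An odd shift would carry a step across a (x)-vertex to a step across a *-vertex. *)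
exfalso; have [e1 _] := line_step k hl.
have [e2 [b hb]] := line_step (k + m%:Z) hl.
have := hM (2 * k + 1); rewrite e1.
have -> : (farey_act M (l (2 * k)%R * mod_S)%g = farey_act M (l (2 * k)%R) * mod_S)%g.
  exact: mulgA.
rewrite hM.
have -> : 2 * k + 1 + m.*2.+1%:Z = 2 * (k + m%:Z + 1) by lia.
have -> : 2 * k + m.*2.+1%:Z = 2 * (k + m%:Z) + 1 by lia.
rewrite hb e2 -!mulgA => /mulgI; rewrite mod_SS.
case: b {hb} => /= h.
  by apply: mod_S_neq_RR; rewrite -[mod_S]mulg1 h !mulgA mod_SS mul1g.
by apply: mod_S_neq_R; rewrite -[mod_S]mulg1 h !mulgA mod_SS mul1g.
Qed.

(** The line repeats the word of [M] at [W] periodically in both directions, and [M] shifts it by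
    one period. *)
Lemma ax_axis_line M W : hyperbolic M -> ax M W -> exists2 l, axis_line M l & l 0 = W.
Proof.
move=> hyp [w hw]; have w0 : (0 < size w)%N.
  by have := ax_word_neq0 hyp hw; case: (w).
pose m := size w; pose a j := nth false w (j %% m).
have [X XE] : exists X : nat -> PSL2Z, forall N, X N = (W * word (mkseq a N))%g.
  by eexists.
have X_S N : X N.+1 = (X N * letter (a N))%g by rewrite !XE mkseqS word_rcons mulgA.
have X_m N : X (N + m)%N = (M * X N)%g.
  elim: N => [|N IHN]; last by rewrite addSn !X_S IHN mulgA /a modnDr.
  have -> : X (0 + m)%N = (W * word w)%g.
    rewrite XE add0n; congr (_ * word _)%g; rewrite -[RHS](mkseq_nth false).
    apply/eq_in_map => j; rewrite mem_iota /a => /andP[_ jm].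
    by rewrite modn_small.
  by rewrite -hw XE mulg1 conjgE mulVKg.
have X_pow N k : X (N + k * m)%N = (M ^+ k * X N)%g.
  elim: k => [|k IHk]; first by rewrite addn0 mul1g.
  by rewrite mulSn addnCA addnC X_m IHk expgS mulgA.
have absm (i : int) : 0 <= i + (`|i| * m)%:Z.
  by have := leq_pmulr `|i| w0; rewrite -/m; lia.
(* Y i is M^-K X (i + K m) for any K with i + K m >= 0; take K = |i|. *)
have [Y YE] : exists Y : int -> PSL2Z,
    forall i, Y i = (M ^- `|i|%N * X `|(i + (`|i| * m)%:Z)%R|%N)%g by eexists.
have Y_spec i K N : N%:Z = i + (K * m)%:Z -> Y i = (M ^- K * X N)%g.
  move=> hN; rewrite YE; set K' := `|i|%N; set N' := absz _.
  have hN' : N'%:Z = i + (K' * m)%:Z by rewrite /N' gez0_abs // absm.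
  case: (leqP K K') => h.
    have -> : N' = (N + (K' - K) * m)%N.
      by rewrite mulnBl; have := leq_mul h (leqnn m); lia.
    by rewrite X_pow mulgA -{1}(subnK h) expgnDr invgM mulgVK.
  have -> : N = (N' + (K - K') * m)%N.
    by rewrite mulnBl; have := leq_mul (ltnW h) (leqnn m); lia.
  by rewrite X_pow mulgA -{1}(subnK (ltnW h)) expgnDr invgM mulgVK.
have Y_step i : exists b, Y (i + 1) = (Y i * letter b)%g.
  have [K [N hN]] : exists K N : nat, N%:Z = i + (K * m)%:Z.
    by exists `|i|%N, `|(i + (`|i| * m)%:Z)%R|%N; rewrite gez0_abs // absm.
  exists (a N); rewrite (Y_spec _ _ _ hN) (Y_spec (i + 1) K N.+1); last by lia.
  by rewrite X_S mulgA.
have Y_m i : Y (i + m%:Z) = (M * Y i)%g.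
  have [K [N hN]] : exists K N : nat, N%:Z = i + (K * m)%:Z.
    by exists `|i|%N, `|(i + (`|i| * m)%:Z)%R|%N; rewrite gez0_abs // absm.
  rewrite (Y_spec _ _ _ hN) (Y_spec (i + m%:Z) K (N + m)%N); last by lia.
  rewrite X_m !mulgA; congr (_ * _)%g.
  by rewrite (commuteV (commuteX K (commute_refl M))).
pose l (k : int) : PSL2Z :=
  if (k %% 2)%Z == 0 then Y (k %/ 2)%Z else (Y (k %/ 2)%Z * mod_S)%g.
have l_even i : l (2 * i)%R = Y i.
  rewrite /l; have -> : (2 * i %% 2)%Z = 0 by lia.
  by rewrite eqxx; congr Y; lia.
have l_odd i : l (2 * i + 1)%R = (Y i * mod_S)%g.
  rewrite /l; have -> : ((2 * i + 1) %% 2)%Z = 1 by lia.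
  by congr (Y _ * _)%g; lia.
exists l; last first.
  by rewrite -[0](mulr0 2) l_even YE invg1 mul1g XE mulg1.
split => [k|]; last first.
  (* Each of the [m] letters of the period spans two edges. *)
  exists m.*2; first by rewrite double_gt0.
  move=> k; have [i [->|->]] : exists i, k = 2 * i \/ k = 2 * i + 1.
    by exists (k %/ 2)%Z; lia.
  - have -> : 2 * i + m.*2%:Z = 2 * (i + m%:Z) by lia.
    by rewrite !l_even Y_m.
  - have -> : 2 * i + 1 + m.*2%:Z = 2 * (i + m%:Z) + 1 by lia.
    by rewrite !l_odd Y_m -mulgA.
have -> : 2 * k + 2 = 2 * (k + 1) by lia.
have [b hb] := Y_step k; rewrite !l_even l_odd hb.
split.
- exact: mulg_neq mod_S_neq1.
- by rewrite [RHS]farey_oend_next.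
- case: b {hb} => /=; rewrite !mulgA; last exact: mulg_neq mod_R_neq1.
  by rewrite -[X in _ <> X]mulgA; exact: mulg_neq mod_RR_neq1.
- case: b {hb} => /=; rewrite !mulgA ?[RHS]farey_bend_next //.
Qed.

(** * Spines and their orientations *)

(** Induction around the spine: thanks to the invariance under [M], forward steps suffice to reach
    [W'], by [ax_connected]. *)
Lemma ax_propagate M (T : PSL2Z -> Prop) W W' : hyperbolic M ->
  (forall k X, T (M ^+ k * X)%g <-> T X) ->
  (forall X a, ax M X -> ax M (X * letter a)%g -> T X -> T (X * letter a)%g) ->
  ax M W -> ax M W' -> T W -> T W'.
Proof.
move=> hM TM Tstep [w hw] hW' TW.
have [k [v e]] := ax_connected hM hw hW'; apply/(TM k); rewrite e.
have {hW'} : ax M (W * word v)%g by rewrite -e; apply/ax_pow.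
elim: v W w hw TW {e W' k} => [|a v IHv] W w hw TW hv; first by rewrite mulg1.
have [w1 wE] := ax_step hM hw hv; rewrite wE in hw.
have hw' := ax_rot hw; rewrite /= mulgA.
apply: (IHv _ _ hw'); last by rewrite -mulgA.
by apply: Tstep => //; [exists (a :: w1)|exists (rcons w1 a)].
Qed.

Lemma iter_farey_act M n W : iter n (farey_act M) W = (M ^+ n * W)%g.
Proof. by elim: n => [|n IHn] /=; rewrite ?mul1g // expgS -mulgA -IHn. Qed.

(** [M] presents the quotient and [N] gives the direction; both generate the same subgroup. *)
Definition eq_or_inv (M N : PSL2Z) : Prop := M = N \/ M = N^-1%g.

Lemma cark_projP M N W W' : eq_or_inv M N -> cark_proj M W = cark_proj M W' <->
  exists n, (N ^+ n * W)%g = W' \/ (N ^+ n * W')%g = W.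
Proof.
move=> hMN; have -> : cark_proj M W = cark_proj M W' <->
    exists n, (M ^+ n * W)%g = W' \/ (M ^+ n * W')%g = W.
  split=> [/(congr1 val) /= h|[n hn]].
    have : cyc_orbit (farey_act M) W W' by rewrite h; exact: cyc_orbit_refl.
    by move=> [n hn]; exists n; rewrite -!iter_farey_act.
  by apply: edge_proj_orbit; exists n; rewrite !iter_farey_act.
case: hMN => -> //; split=> -[n [hn|hn]]; exists n; rewrite -hn;
  by rewrite expVgn ?mulKg ?mulVKg; auto.
Qed.

Lemma cark_proj_pow M k W : cark_proj M (M ^+ k * W)%g = cark_proj M W.
Proof. by apply/(@cark_projP M M); [left|exists k; right]. Qed.

Lemma cark_proj_mulr M W W' X : cark_proj M W = cark_proj M W' ->
  cark_proj M (W * X)%g = cark_proj M (W' * X)%g.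
Proof.
move=> /(@cark_projP M M) [|n hn]; first by left.
apply/(@cark_projP M M); first by left.
by exists n; rewrite !mulgA; case: hn => ->; [left|right].
Qed.

Lemma cark_proj_mulr_inj M W W' X : cark_proj M (W * X)%g = cark_proj M (W' * X)%g ->
  cark_proj M W = cark_proj M W'.
Proof. by move=> /(cark_proj_mulr X^-1%g); rewrite !mulgK. Qed.

Lemma cark_proj_surj M (x : edge (cark M)) : exists W, x = cark_proj M W.
Proof. by have [W ->] := quot_edgeP x; exists W. Qed.

Lemma cark_onext M W : @onext (cark M) (cark_proj M W) = cark_proj M (W * mod_S)%g.
Proof. exact: quot_onext_proj. Qed.

Lemma cark_bnext M W : @bnext (cark M) (cark_proj M W) = cark_proj M (W * mod_R)%g.
Proof. exact: quot_bnext_proj. Qed.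

Lemma cark_oend_eq M W y : @oend (cark M) (cark_proj M W) = oend y ->
  y = cark_proj M W \/ y = cark_proj M (W * mod_S)%g.
Proof.
move=> /onext_trans[n <-]; elim: n => [|n [] IHn]; rewrite ?iterS; first by left.
  by right; rewrite IHn cark_onext.
by left; rewrite IHn cark_onext -mulgA mod_SS mulg1.
Qed.

Lemma cark_bend_eq M W y : @bend (cark M) (cark_proj M W) = bend y ->
  [\/ y = cark_proj M W, y = cark_proj M (W * mod_R)%g |
      y = cark_proj M (W * mod_R * mod_R)%g].
Proof.
move=> /bnext_trans[n <-]; elim: n => [|n [] IHn]; rewrite ?iterS; first by apply: Or31.
- by apply: Or32; rewrite IHn cark_bnext.
- by apply: Or33; rewrite IHn cark_bnext.
- apply: Or31; rewrite IHn cark_bnext -!mulgA [(mod_R * (_ * _))%g]mulgA.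
  by rewrite mod_RRR mulg1.
Qed.

Lemma cark_oend_S M W :
  @oend (cark M) (cark_proj M (W * mod_S)%g) = oend (cark_proj M W).
Proof. by rewrite -cark_onext oend_next. Qed.

Lemma cark_bend_letter M W a :
  @bend (cark M) (cark_proj M (W * letter a)%g) = bend (cark_proj M (W * mod_S)%g).
Proof. by rewrite /letter; case: a; rewrite !mulgA -!cark_bnext !bend_next. Qed.

Lemma hyperbolic_eq_or_inv M N : eq_or_inv M N -> hyperbolic M -> hyperbolic N.
Proof. by case=> -> //; move/hyperbolicV; rewrite invgK. Qed.

Lemma mulgSS (W : PSL2Z) : (W * mod_S * mod_S)%g = W.
Proof. by rewrite -mulgA mod_SS mulg1. Qed.

(** With [ax_SRR]: at most one of the three edges at a *-vertex is traversed towards it. *)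
Lemma ax_SR M W : hyperbolic M -> ax M (W * mod_S)%g -> ~ ax M (W * mod_R * mod_S)%g.
Proof. by move=> hM; rewrite -!axV //; apply/ax_R/hyperbolicV. Qed.

Lemma ax_SRR M W : hyperbolic M -> ax M (W * mod_S)%g ->
  ~ ax M (W * mod_R * mod_R * mod_S)%g.
Proof. by move=> hM; rewrite -!axV //; apply/ax_RR/hyperbolicV. Qed.

Lemma ax_cark_proj M N W W' : eq_or_inv M N -> cark_proj M W = cark_proj M W' ->
  ax N W <-> ax N W'.
Proof. by move=> hMN /(cark_projP _ _ hMN)[n []<-]; rewrite ax_pow. Qed.

(* The edges of the spine of <M>\F that are traversed towards their *-vertex in
   the direction of [N], where [N] is [M] or its inverse. *)
Definition dir_edges (M N : PSL2Z) : set (edge (cark M)) :=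
  [set x | exists2 W, ax N W & x = cark_proj M (W * mod_S)%g].

Lemma dir_edgesE M N W : eq_or_inv M N ->
  dir_edges N (cark_proj M W) <-> ax N (W * mod_S)%g.
Proof.
move=> hMN; split=> [[X hX e]|h]; last by exists (W * mod_S)%g; rewrite ?mulgSS.
have := cark_proj_mulr mod_S e; rewrite mulgSS => e'.
by apply/(ax_cark_proj hMN e').
Qed.

Lemma spineE M N W : hyperbolic M -> eq_or_inv M N ->
  spine M (cark_proj M W) <-> ax N W \/ ax N (W * mod_S)%g.
Proof.
move=> hM hMN.
suff main : spine M (cark_proj M W) <-> ax M W \/ ax M (W * mod_S)%g.
  rewrite main; case: hMN => [->//|MN].
  have hN := hyperbolicV hM; rewrite MN invgK in hN.
  by rewrite MN !axV // mulgSS or_comm.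
have MM : eq_or_inv M M by left.
split=> [[l [i [hl e]]]|[] h].
- have [k [iE|iE]] : exists k, i = 2 * k \/ i = 2 * k + 1 by exists (i %/ 2)%Z; lia.
    by left; rewrite (ax_cark_proj MM e) iE; case: (axis_line_ax hl k).
  right; have [h1 h2] := axis_line_ax hl k.
  have := cark_proj_mulr mod_S e; rewrite iE h2 mulgSS => e'.
  by rewrite (ax_cark_proj MM e').
- by have [l hl l0] := ax_axis_line hM h; exists l, 0; rewrite l0.
- have [l hl l0] := ax_axis_line hM h; exists l, (2 * 0 + 1); split => //.
  by have [_ ->] := axis_line_ax hl 0; rewrite mulr0 l0 mulgSS.
Qed.

Lemma directed_byE M : hyperbolic M -> dc_dir (directed_by M) = @dir_edges M M.
Proof.
move=> hM; apply/seteqP; split=> x /=.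
  move=> [l [k [hl ->]]]; have [h1 h2] := axis_line_ax hl k.
  by exists (l (2 * k)); rewrite ?h2.
move=> [W h ->]; have [l hl l0] := ax_axis_line hM h; exists l, 0; split => //.
by have [_ ->] := axis_line_ax hl 0; rewrite mulr0 l0.
Qed.

(** No edge is traversed both ways, and at each vertex at most one edge enters and at most one
    leaves. *)
Lemma dir_edges_orientation M N : hyperbolic M -> eq_or_inv M N ->
  is_orientation (spine M) (@dir_edges M N).
Proof.
move=> hM hMN; have hN := hyperbolic_eq_or_inv hMN hM.
split=> [x [W hW ->]|e e' he he' neq share].
  by apply/(spineE _ hM hMN); rewrite mulgSS; right.
have [W eE] := cark_proj_surj e; rewrite {e}eE in he neq share *.
move/(spineE _ hM hMN): he => he.
have nS X : ax N X -> ax N (X * mod_S)%g -> False by move=> h /(ax_S hN h).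
case: share => [/cark_oend_eq|/cark_bend_eq] share.
  have {}share : e' = cark_proj M (W * mod_S)%g by case: share neq => // ->.
  rewrite share !dir_edgesE // mulgSS; have := nS W; tauto.
have {share} [eE|eE] : e' = cark_proj M (W * mod_R)%g \/
    e' = cark_proj M (W * mod_R * mod_R)%g.
- by case: share neq; [move=> -> []|left|right].
- rewrite eE in he' *; move/(spineE _ hM hMN): he' => he'.
  rewrite !dir_edgesE //; have := nS W; have := nS (W * mod_R)%g.
  have := @ax_R N W hN; have := @ax_SR N W hN; tauto.
- rewrite eE in he' *; move/(spineE _ hM hMN): he' => he'.
  rewrite !dir_edgesE //; have := nS W; have := nS (W * mod_R * mod_R)%g.
  have := @ax_RR N W hN; have := @ax_SRR N W hN; tauto.
Qed.

(** The spine is a single circuit, so its orientation is known from one edge: it is the direction of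
    [M] or of its inverse. *)
Lemma orientation_dir_edges M X : hyperbolic M -> is_orientation (spine M) X ->
  exists2 N, eq_or_inv M N & X = @dir_edges M N.
Proof.
move=> hM [sub alt]; have MM : eq_or_inv M M by left.
have [W0 hW0] := ax_exists hM.
have inS W : ax M W -> spine M (cark_proj M (W * mod_S)%g).
  by move=> h; apply/(spineE _ hM MM); rewrite mulgSS; right.
have inE W : ax M W -> spine M (cark_proj M W).
  by move=> h; apply/(spineE _ hM MM); left.
have altS W : ax M W -> X (cark_proj M (W * mod_S)%g) <-> ~ X (cark_proj M W).
  move=> h; apply: alt; [exact: inS|exact: inE| |by left; rewrite cark_oend_S].
  by move=> /(ax_cark_proj MM) e; apply: (ax_S hM h); apply/e.
have altL W a : ax M W -> ax M (W * letter a)%g ->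
    X (cark_proj M (W * mod_S)%g) <-> ~ X (cark_proj M (W * letter a)%g).
  move=> h h'; apply: alt; [exact: inS|exact: inE| |by right; rewrite cark_bend_letter].
  by move=> /(ax_cark_proj MM) e; apply: (ax_S hM h); apply/e.
pose T (b : bool) W := X (cark_proj M (W * mod_S)%g) <-> b.
have Tall b W : T b W0 -> ax M W -> T b W.
  move=> T0 hW; apply: (ax_propagate (T := T b) hM _ _ hW0 hW T0).
    by move=> k Y; rewrite /T -mulgA cark_proj_pow.
  (* One letter crosses a *-vertex and a (x)-vertex, and membership in [X] flips at each. *)
  move=> Y a hY hYa; rewrite /T; have := altL Y a hY hYa; have := altS _ hYa.
  by case: (pselect (X (cark_proj M (Y * letter a)%g))); tauto.
have notS W : ~ (ax M W /\ ax M (W * mod_S)%g) by move=> [h] /(ax_S hM h).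
have [XW0|XW0] := pselect (X (cark_proj M (W0 * mod_S)%g)).
  exists M => //; apply/seteqP; split=> [x Xx|x [W hW ->]]; last first.
    by apply/(Tall true).
  have [W xE] := cark_proj_surj x; have := sub x Xx; rewrite xE in Xx *.
  rewrite (spineE _ hM MM) dir_edgesE // => -[h|//].
  by case: ((altS W h).1 _ Xx); apply/(Tall true).
exists M^-1%g; first by right; rewrite invgK.
apply/seteqP; split=> [x Xx|x].
  have [W xE] := cark_proj_surj x; have := sub x Xx; rewrite xE in Xx *.
  rewrite (spineE _ hM MM) dir_edgesE ?axV ?mulgSS //; last by right; rewrite invgK.
  case=> // h; have [] : T false (W * mod_S)%g by apply: Tall.
  by rewrite mulgSS => /(_ Xx).
have [W ->] := cark_proj_surj x.
rewrite dir_edgesE ?axV ?mulgSS //; last by right; rewrite invgK.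
move=> h; have [Xf _] : T false W by apply: Tall.
by apply: contrapT => h'; have := (altS W h).2 h'; move/Xf.
Qed.

(** * Isomorphisms *)

(** A permutation and its inverse have the same orbits, so [h] may conjugate [f] to [g] or to the
    inverse of [g]. *)
Lemma image_cyc_orbit_conj T U (f : T -> T) (g : U -> U) (h : T -> U) x :
  bijective f -> injective g ->
  (forall y, g (h y) = h (f y)) \/ (forall y, g (h (f y)) = h y) ->
  h @` cyc_orbit f x = cyc_orbit g (h x).
Proof.
move=> bf ig [gh|gh]; first exact: image_cyc_orbit.
have [f' fK f'K] := bf; have iterK n y : iter n f (iter n f' y) = y.
  by elim: n y => // n IHn y; rewrite iterSr iterS f'K.
have iterK' n y : iter n f' (iter n f y) = y.
  by elim: n y => // n IHn y; rewrite iterSr iterS fK.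
have -> : cyc_orbit f x = cyc_orbit f' x.
  by apply/seteqP; split=> y [n [<-|<-]]; exists n; rewrite ?iterK ?iterK'; auto.
by apply: image_cyc_orbit => // [|y]; [exists f|rewrite -{1}(f'K y) gh].
Qed.

Lemma image_bijK T U (f : T -> U) g X : cancel f g -> g @` (f @` X) = X.
Proof.
by move=> fK; rewrite image_comp -[RHS]image_id; congr image; apply/funext => x /=.
Qed.

(** * Isomorphisms of quotients induced by an automorphism *)

Section QuotientIso.
Variables (G : ribbonGraph) (m m' n : ribbonIso G G).
Hypothesis conjE : (forall e, m' (n e) = n (m e)) \/ (forall e, m' (n (m e)) = n e).
Hypothesis conjO : (forall v, isoO m' (isoO n v) = isoO n (isoO m v)) \/
  (forall v, isoO m' (isoO n (isoO m v)) = isoO n v).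
Hypothesis conjB : (forall v, isoB m' (isoB n v) = isoB n (isoB m v)) \/
  (forall v, isoB m' (isoB n (isoB m v)) = isoB n v).

Let imE e : n @` cyc_orbit m e = cyc_orbit m' (n e).
Proof.
by apply: image_cyc_orbit_conj conjE; [exact: isoE_bij|exact/bij_inj/isoE_bij].
Qed.

Let imO v : isoO n @` cyc_orbit (isoO m) v = cyc_orbit (isoO m') (isoO n v).
Proof.
by apply: image_cyc_orbit_conj conjO; [exact: isoO_bij|exact/bij_inj/isoO_bij].
Qed.

Let imB v : isoB n @` cyc_orbit (isoB m) v = cyc_orbit (isoB m') (isoB n v).
Proof.
by apply: image_cyc_orbit_conj conjB; [exact: isoB_bij|exact/bij_inj/isoB_bij].
Qed.

Lemma quot_isoE_subproof (x : quot_edge m) : range (cyc_orbit m') (n @` val x).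
Proof. by case: (set_valP x) => e _ <-; exists (n e); rewrite ?imE. Qed.

Lemma quot_isoO_subproof (x : quot_overt m) :
  range (cyc_orbit (isoO m')) (isoO n @` val x).
Proof. by case: (set_valP x) => e _ <-; exists (isoO n e); rewrite ?imO. Qed.

Lemma quot_isoB_subproof (x : quot_bvert m) :
  range (cyc_orbit (isoB m')) (isoB n @` val x).
Proof. by case: (set_valP x) => e _ <-; exists (isoB n e); rewrite ?imB. Qed.

Definition quot_isoE (x : quot_edge m) : quot_edge m' :=
  SigSub (mem_set (quot_isoE_subproof x)).
Definition quot_isoO (x : quot_overt m) : quot_overt m' :=
  SigSub (mem_set (quot_isoO_subproof x)).
Definition quot_isoB (x : quot_bvert m) : quot_bvert m' :=
  SigSub (mem_set (quot_isoB_subproof x)).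

Lemma orbit_image_bij (T : Type) (f g h : T -> T)
    (F : range (cyc_orbit f) -> range (cyc_orbit g)) :
  bijective h -> (forall x, val (F x) = h @` val x) ->
  (forall x, h @` cyc_orbit f x = cyc_orbit g (h x)) -> bijective F.
Proof.
move=> [h' hK h'K] FE hfg; rewrite -setTT_bijective; split=> //.
  move=> x y _ _ /(congr1 val); rewrite !FE => /(congr1 (image^~ h')).
  by rewrite !(image_bijK _ hK) => /val_inj.
move=> y _; case: (set_valP y) => e _ ye.
exists (SigSub (mem_set (imageT (cyc_orbit f) (h' e)))) => //.
by apply/val_inj; rewrite FE /= hfg h'K.
Qed.

Lemma quot_isoE_bij : bijective quot_isoE.
Proof. exact: (orbit_image_bij (isoE_bij n)). Qed.

Lemma quot_isoO_bij : bijective quot_isoO.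
Proof. exact: (orbit_image_bij (isoO_bij n)). Qed.

Lemma quot_isoB_bij : bijective quot_isoB.
Proof. exact: (orbit_image_bij (isoB_bij n)). Qed.

Lemma quot_iso_oend x : quot_oend (quot_isoE x) = quot_isoO (quot_oend x).
Proof.
apply/val_inj; rewrite /= !image_comp; congr image; apply/funext => e /=.
exact: iso_oend.
Qed.

Lemma quot_iso_bend x : quot_bend (quot_isoE x) = quot_isoB (quot_bend x).
Proof.
apply/val_inj; rewrite /= !image_comp; congr image; apply/funext => e /=.
exact: iso_bend.
Qed.

Lemma quot_iso_onext x : quot_onext (quot_isoE x) = quot_isoE (quot_onext x).
Proof.
apply/val_inj; rewrite /= !image_comp; congr image; apply/funext => e /=.
exact: iso_onext.
Qed.

Lemma quot_iso_bnext x : quot_bnext (quot_isoE x) = quot_isoE (quot_bnext x).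
Proof.
apply/val_inj; rewrite /= !image_comp; congr image; apply/funext => e /=.
exact: iso_bnext.
Qed.

Definition quot_iso : ribbonIso (quot_graph m) (quot_graph m') :=
  @RibbonIso (quot_graph m) (quot_graph m') quot_isoE quot_isoO quot_isoB
    quot_isoE_bij quot_isoO_bij quot_isoB_bij quot_iso_oend quot_iso_bend
    quot_iso_onext quot_iso_bnext.

Lemma quot_iso_proj e : quot_iso (edge_proj m e) = edge_proj m' (n e).
Proof. by apply/val_inj; exact: imE. Qed.

End QuotientIso.

Lemma cark_iso_conj M M' V : eq_or_inv (M ^ V^-1)%g M' ->
  exists phi : ribbonIso (cark M) (cark M'),
    forall W, phi (cark_proj M W) = cark_proj M' (V * W)%g.
Proof.
have surjO (v : overt farey) : exists W, v = farey_oend W.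
  by case: (set_valP v) => W _ h; exists W; apply/val_inj.
have surjB (v : bvert farey) : exists W, v = farey_bend W.
  by case: (set_valP v) => W _ h; exists W; apply/val_inj.
move=> hMM'.
have hE : (forall W, M' * (V * W) = V * (M * W))%g \/
          (forall W, M' * (V * (M * W)) = V * W)%g.
  case: hMM' => [<-|h]; [left|right] => W.
    by rewrite conjgE invgK !mulgA mulgVK.
  have -> : M' = (M^-1 ^ V^-1)%g by rewrite conjVg h invgK.
  by rewrite conjgE invgK !mulgA !mulgVK.
have hO : (forall v, farey_actO M' (farey_actO V v) = farey_actO V (farey_actO M v)) \/
    (forall v, farey_actO M' (farey_actO V (farey_actO M v)) = farey_actO V v).
  by case: hE => h; [left|right] => v; have [W ->] := surjO v;
    rewrite -!farey_act_oend h.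
have hB : (forall v, farey_actB M' (farey_actB V v) = farey_actB V (farey_actB M v)) \/
    (forall v, farey_actB M' (farey_actB V (farey_actB M v)) = farey_actB V v).
  by case: hE => h; [left|right] => v; have [W ->] := surjB v;
    rewrite -!farey_act_bend h.
exists (@quot_iso farey (farey_act M) (farey_act M') (farey_act V) hE hO hB) => W.
exact: quot_iso_proj.
Qed.

(** An isomorphism commutes with right multiplication by [mod_S] and [mod_R], which generate the
    group; it is determined by the image of the edge 1. *)
Lemma cark_iso_lift M M' (phi : ribbonIso (cark M) (cark M')) :
  exists V, forall W, phi (cark_proj M W) = cark_proj M' (V * W)%g.
Proof.
have [V hV] := cark_proj_surj (phi (cark_proj M 1%g)).
exists V => W; rewrite -[W in LHS]mul1g.
pose Q W := phi (cark_proj M W) = cark_proj M' (V * W)%g.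
suff : Q (1 * W)%g by rewrite /Q mul1g.
apply: PSL2Z_ind => [X|X|]; rewrite /Q ?mulg1 // => h.
  by rewrite -cark_onext -iso_onext h cark_onext mulgA.
by rewrite -cark_bnext -iso_bnext h cark_bnext mulgA.
Qed.

Lemma hyperbolic_pow_inj M a b : hyperbolic M -> (M ^+ a = M ^+ b)%g -> a = b.
Proof.
move=> hM /(congr1 (conjg^~ _)) e; have [W [w hw]] := ax_exists hM.
have := e W; rewrite !conjXg hw -!word_pow => /word_inj/(congr1 size).
rewrite !size_pow; have := ax_word_neq0 hM hw; case: w {hw} => // c w _.
by move=> /eqP; rewrite eqn_pmul2r // => /eqP.
Qed.

(** Composing gives [M ^+ (n * m)] equal to [M] or its inverse; as [M] has infinite order,
    [n = 1]. *)
Lemma mutual_powers M P n m : hyperbolic M -> eq_or_inv P (M ^+ n)%g ->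
  eq_or_inv M (P ^+ m)%g -> eq_or_inv P M.
Proof.
move=> hM hP hMP; have : (M ^+ (n * m) = M \/ M ^+ (n * m) = M^-1)%g.
  rewrite expgnA; case: hMP hP => eM [] eP.
  - by left; rewrite -eP -eM.
  - have -> : (M ^+ n = P^-1)%g by rewrite eP invgK.
    by right; rewrite expVgn -eM.
  - by right; rewrite -eP -[(P ^+ m)%g]invgK -eM.
  - have -> : (M ^+ n = P^-1)%g by rewrite eP invgK.
    by left; rewrite expVgn -eM.
case=> [|e].
  rewrite -{2}[M]expg1 => /(hyperbolic_pow_inj hM)/eqP.
  by rewrite muln_eq1 => /andP[/eqP n1 _]; rewrite n1 expg1 in hP.
have : (M ^+ (n * m).+1 = M ^+ 0)%g by rewrite expgSr e mulVg.
by move=> /(hyperbolic_pow_inj hM).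
Qed.

(** V M V^-1 and [M'] generate the same subgroup: one inclusion holds because [phi] is well defined
    on orbits, the other because it is injective. *)
Lemma cark_iso_conj_mx M M' (phi : ribbonIso (cark M) (cark M')) V : hyperbolic M' ->
  (forall W, phi (cark_proj M W) = cark_proj M' (V * W)%g) ->
  eq_or_inv (M ^ V^-1)%g M'.
Proof.
move=> hM' hV; set P := (M ^ V^-1)%g.
have MV : (V * M = P * V)%g by rewrite /P conjgE invgK !mulgA mulgVK.
have [n hn] : exists n, eq_or_inv P (M' ^+ n)%g.
  have : cark_proj M' (P * V)%g = cark_proj M' (1 * V)%g.
    have e : cark_proj M M = cark_proj M 1%g.
      by have := cark_proj_pow M 1 1%g; rewrite expg1 mulg1.
    by rewrite -MV -hV e hV mulg1 mul1g.
  move=> /cark_proj_mulr_inj/(@cark_projP M' M')[|n hn]; first by left.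
  exists n; case: hn => hn; last by left; rewrite -hn mulg1.
  by right; rewrite -[RHS]mulg1 -hn mulKg.
have [m hm] : exists m, eq_or_inv M' (P ^+ m)%g.
  pose Q := (M' ^ V)%g; have QV : (V * Q = M' * V)%g by rewrite /Q conjgE mulVKg.
  have : phi (cark_proj M Q) = phi (cark_proj M 1%g).
    by rewrite !hV QV mulg1 -[X in (X * V)%g]expg1 cark_proj_pow.
  move=> /(bij_inj (isoE_bij phi))/(@cark_projP M M)[|m hm]; first by left.
  have -> : M' = (Q ^ V^-1)%g by rewrite conjgK.
  exists m; rewrite /P -conjXg; case: hm => hm; last by left; rewrite -hm mulg1.
  by right; rewrite -conjVg; congr (_ ^ _)%g; rewrite -[RHS]mulg1 -hm mulKg.
exact: (mutual_powers hM' hn hm).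
Qed.

Lemma eq_or_inv_sym M N : eq_or_inv M N -> eq_or_inv N M.
Proof. by case=> ->; [left|right; rewrite invgK]. Qed.

Lemma eq_or_inv_trans M N K : eq_or_inv M N -> eq_or_inv N K -> eq_or_inv M K.
Proof. by case=> -> [] ->; rewrite /eq_or_inv ?invgK; auto. Qed.

Lemma eq_or_invJ M N V : eq_or_inv M N -> eq_or_inv (M ^ V)%g (N ^ V)%g.
Proof. by case=> ->; rewrite /eq_or_inv ?conjVg; auto. Qed.

(** A lift [V] of the isomorphism conjugates [N] to [N'] or to its inverse. The direction excludes
    the inverse, since the image of an edge traversed towards its (x)-vertex is traversed in the
    same way. *)
Lemma dcark_iso_dir_edges M M' N N' : hyperbolic M -> hyperbolic M' ->
  eq_or_inv M N -> eq_or_inv M' N' ->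
  dcark_iso (DCarkData (@dir_edges M N)) (DCarkData (@dir_edges M' N')) <->
  exists V, N' = (N ^ V)%g.
Proof.
move=> hM hM' hMN hMN'.
have hN := hyperbolic_eq_or_inv hMN hM; have hN' := hyperbolic_eq_or_inv hMN' hM'.
split=> [[phi /= hphi]|[V hV]].
  have [V /= hV] := cark_iso_lift phi; exists V^-1%g.
  have /= hMM' := cark_iso_conj_mx hM' hV.
  have [W hW] := ax_exists hN.
  have axV' : ax N' (V * W)%g.
    rewrite -(mulgSS (V * W)%g); apply/(dir_edgesE _ hMN').
    rewrite -hphi.
    exists (cark_proj M (W * mod_S)%g); last by rewrite hV mulgA.
    by exists W.
  have axV'' : ax (N ^ V^-1)%g (V * W)%g by rewrite /ax conjgM conjgKV.
  have [//|e] : eq_or_inv (N ^ V^-1)%g N'.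
    apply: eq_or_inv_trans (eq_or_inv_trans _ hMM') hMN'.
    exact/eq_or_invJ/eq_or_inv_sym.
  by move: axV''; rewrite e axV // => /(ax_S hN' axV').
have hMM' : eq_or_inv (M ^ V^-1^-1)%g M'.
  rewrite invgK; apply: eq_or_inv_trans (eq_or_invJ V hMN) _.
  by rewrite -hV; exact: eq_or_inv_sym.
have [phi hphi] := cark_iso_conj hMM'; exists phi => /=.
apply/seteqP; split=> [_ [_ [W hW ->] <-]|_ [W hW ->]].
  exists (V^-1 * W)%g; last by rewrite hphi mulgA.
  by rewrite hV /ax -conjgM mulVKg.
exists (cark_proj M (V * W * mod_S)%g); last by rewrite hphi !mulgA mulVg mul1g.
by exists (V * W)%g => //; rewrite /ax conjgM -hV.
Qed.

(** * Cyclic words *)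

Lemma ax_pow_word N W w k : (N ^ W)%g = word w ->
  (N ^+ k * W)%g = (W * word (flatten (nseq k w)))%g.
Proof. by move=> hw; rewrite word_pow -hw -conjXg conjgE mulVKg. Qed.

(** The entering edges are the [Z i * mod_S], where [Z i] is reached from [W] by reading [i] letters
    of [w]. *)
Lemma spine_word_ax M N w W : hyperbolic M -> eq_or_inv M N -> (N ^ W)%g = word w ->
  spine_word (DCarkData (@dir_edges M N)) w.
Proof.
move=> hM hMN hw; have hN := hyperbolic_eq_or_inv hMN hM.
have n0 : (0 < size w)%N by have := ax_word_neq0 hN hw; case: (w).
set n := size w in n0; pose Z i : PSL2Z := (W * word (take i w))%g.
have projN k X : cark_proj M (N ^+ k * X)%g = cark_proj M X.
  by apply/(cark_projP _ _ hMN); exists k; right.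
have Zrot i : (N ^ Z i)%g = word (drop i w ++ take i w).
  by apply: ax_prefix; rewrite cat_take_drop.
have axZ i : ax N (Z i) by exists (drop i w ++ take i w).
have ZS i : (i < n)%N -> Z i.+1 = (Z i * letter (nth false w i))%g.
  by move=> lt; rewrite /Z (take_nth false lt) word_rcons mulgA.
have Zletter i a : (i < n)%N -> ax N (Z i * letter a)%g -> a = nth false w i.
  move=> lt h; have [|w1] := @ax_step N (Z i) _ a [::] hN (Zrot i).
    by rewrite /= mulg1.
  by rewrite (drop_nth false lt) => -[->].
have projZn : cark_proj M (Z n) = cark_proj M (Z 0%N).
  by rewrite /Z take_size take0 mulg1 -hw conjgE mulVKg -(projN 1%N W) expg1.
have projS X Y : cark_proj M X = cark_proj M Y ->
  cark_proj M (X * mod_S)%g = cark_proj M (Y * mod_S)%g by exact: cark_proj_mulr.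
exists (fun i => cark_proj M (Z i * mod_S)%g); split => //=.
- by split=> //; exact: projS.
(* If a power of [N] carries one of these edges to another, comparing lengths of words shows that
   its exponent is 0. *)
- move=> i j lti ltj /cark_proj_mulr_inj/(cark_projP _ _ hMN)[k].
  have key a b : (a < n)%N -> (b < n)%N -> (N ^+ k * Z a = Z b)%g -> a = b.
    move=> lta ltb; rewrite /Z mulgA (ax_pow_word _ hw) -mulgA => /mulgI.
    rewrite -word_cat => /word_inj/(congr1 size).
    rewrite size_cat size_pow !size_takel ?(ltnW lta) ?(ltnW ltb) // -/n.
    by case: k => [|k]; lia.
  by case=> [/key|/key] -> //.
- apply/seteqP; split=> [x [W' hW' ->]|_ [i lti <-]]; last by exists (Z i).
  pose T W' := exists2 i, (i < n)%N & cark_proj M W' = cark_proj M (Z i).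
  suff [i lti e] : T W' by exists i => //=; exact/esym/projS.
  apply: (ax_propagate (T := T) hN _ _ (axZ 0%N) hW'); last by exists 0%N.
    by move=> k X; rewrite /T projN.
  move=> X a hX hXa [i lti e]; have e' := cark_proj_mulr (letter a) e.
  have aE : a = nth false w i by apply: Zletter => //; apply/(ax_cark_proj hMN e').
  rewrite /T e' aE -ZS //; have [lt|le] := ltnP i.+1 n; first by exists i.+1.
  have -> : i.+1 = n by apply/eqP; rewrite eqn_leq lti le.
  by exists 0%N.
- move=> i lti; exists (cark_proj M (Z i.+1)); split.
  + by apply/(spineE _ hM hMN); left.
  + by move=> /(ax_cark_proj hMN) e; apply: (ax_S hN (axZ i)); apply/e.
  + by rewrite ZS // [LHS]cark_bend_letter.
  + by move=> /(ax_cark_proj hMN) e; apply: (ax_S hN (axZ i.+1)); apply/e.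
  + by rewrite [RHS]cark_oend_S.
(* The edge following the [i]-th one in the cyclic order is [Z i * letter false]; it is on the spine
   exactly when the letter read is [false]. *)
- move=> i lti; have -> : quot_bnext (cark_proj M (Z i * mod_S)%g) =
      cark_proj M (Z i * letter false)%g by rewrite [LHS]cark_bnext /= mulgA.
  rewrite (spineE _ hM hMN).
  case wi: (nth false w i); split=> // h.
    case=> [/(Zletter _ _ lti)|]; first by rewrite wi.
    by rewrite /= !mulgA; apply: ax_SR => //; rewrite mulgSS.
  by case: h; left; have := axZ i.+1; rewrite ZS // wi.
Qed.

(** The edges are lifted one by one along the axis. Closing up after [w] makes [w] a power of the
    word [u] of [N] at the starting edge, and injectivity of [e] leaves exponent 1. *)
Lemma ax_spine_word M N w : hyperbolic M -> eq_or_inv M N ->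
  spine_word (DCarkData (@dir_edges M N)) w -> exists W, (N ^ W)%g = word w.
Proof.
move=> hM hMN [e [[n0 en]]] /= e_inj dirE hf hw.
have hN := hyperbolic_eq_or_inv hMN hM; set n := size w in n0 en e_inj dirE hf hw.
have [W0 hW0 e0] : dir_edges N (e 0%N) by rewrite dirE; exists 0%N.
pose Z i : PSL2Z := (W0 * word (take i w))%g.
have ZP i : (i <= n)%N -> ax N (Z i) /\ e i = cark_proj M (Z i * mod_S)%g.
  elim: i => [|i IHi] lti; first by rewrite /Z take0 mulg1.
  have [axZ eZ] := IHi (ltnW lti).
  have [f [spf fe bf fe' ofe]] := hf i lti.
  have [a fa] : exists a, f = cark_proj M (Z i * letter a)%g.
    move: bf; rewrite eZ => /esym/cark_bend_eq[] fE; first by case: fe; rewrite fE.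
      by exists false; rewrite fE /= mulgA.
    by exists true; rewrite fE /= !mulgA.
  have axa : ax N (Z i * letter a)%g.
    move: spf; rewrite fa (spineE _ hM hMN) => -[//|].
    have axZ' : ax N (Z i * mod_S * mod_S)%g by rewrite mulgSS.
    by case: (a) => /=; rewrite !mulgA; [move/(ax_SRR hN axZ')|move/(ax_SR hN axZ')].
  have aE : a = nth false w i.
    have := hw i lti; rewrite eZ.
    have -> : quot_bnext (cark_proj M (Z i * mod_S)%g) =
      cark_proj M (Z i * letter false)%g by rewrite [LHS]cark_bnext /= mulgA.
    rewrite (spineE _ hM hMN).
    case: a axa {fa} => axa [h1 h2]; last first.
      by apply/esym/negP => /h1; apply; left.
    rewrite h2 // => -[axf|]; last first.
      by rewrite /= !mulgA; apply: ax_SR => //; rewrite mulgSS.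
    have [u hu] := axZ.
    have [|u1 u1E] := @ax_step N (Z i) _ true [::] hN hu; first by rewrite /= mulg1.
    have [|u2] := @ax_step N (Z i) _ false [::] hN hu; first by rewrite /= mulg1.
    by rewrite u1E.
  have ZS : Z i.+1 = (Z i * letter a)%g.
    by rewrite /Z (take_nth false lti) word_rcons mulgA aE.
  rewrite ZS; split=> //.
  move: ofe; rewrite fa => /cark_oend_eq[] // eE.
  by case: fe'; rewrite fa eE.
have [_ eZn] := ZP n (leqnn n); move: en; rewrite eZn e0 => /cark_proj_mulr_inj.
rewrite /Z take_size; have [u hu] := hW0.
move=> /(cark_projP _ _ hMN)[k [hk|hk]].
  exfalso; move: hk; rewrite mulgA (ax_pow_word _ hu) -mulgA -[RHS]mulg1 => /mulgI.
  rewrite -word_cat => /(@word_inj _ [::])/(congr1 size).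
  by rewrite size_cat -/n /=; lia.
move: hk; rewrite (ax_pow_word _ hu) => /mulgI/word_inj wE.
exists W0; rewrite hu; congr word.
case: k wE => [|[|k]] /= wE; first by move: n0; rewrite /n -wE.
  by rewrite -wE cats0.
(* With exponent at least 2, the edges would already return to [e 0] after the shorter word [u]. *)
exfalso; have u0 : (0 < size u)%N by have := ax_word_neq0 hN hu; case: (u).
have un : (size u < n)%N by rewrite /n -wE !size_cat; lia.
have [_ eu] := ZP _ (ltnW un).
suff : size u = 0%N by lia.
apply: e_inj => //; rewrite eu e0; apply: cark_proj_mulr.
rewrite /Z -{1}wE take_size_cat //; apply/(cark_projP _ _ hMN).
by exists 1%N; right; rewrite (ax_pow_word _ hu) /= cats0.
Qed.

(** * The correspondence *)

Lemma is_primitive_carkP M N : hyperbolic M -> eq_or_inv M N ->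
  is_primitive_cark (DCarkData (@dir_edges M N)) <-> prim N.
Proof.
move=> hM hMN; have hN := hyperbolic_eq_or_inv hMN hM; split.
  by move=> [w /(ax_spine_word hM hMN)[W hw] np]; apply/(primP hN hw).
have [W [w hw]] := ax_exists hN; move=> /(primP hN hw) np.
by exists w => //; exact: (spine_word_ax hM hMN hw).
Qed.

Lemma directed_byP M : hyperbolic M -> directed_by M = DCarkData (@dir_edges M M).
Proof. by move=> hM; rewrite -directed_byE. Qed.

Lemma directed_by_directed M : hyperbolic M -> is_directed_cark (directed_by M).
Proof.
move=> hM; rewrite directed_byP //; split => //=.
by apply: dir_edges_orientation => //; left.
Qed.

Lemma directed_carkP d : is_directed_cark d -> exists M N,
  [/\ hyperbolic M, eq_or_inv M N & d = DCarkData (@dir_edges M N)].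
Proof.
case: d => M X [/= hM /(orientation_dir_edges hM)[N hMN ->]].
by exists M, N.
Qed.

(** The class remembers only [N], so every directed cark is isomorphic to one directed by its own
    matrix. *)
Lemma dcark_class_dir_edges M N : hyperbolic M -> eq_or_inv M N ->
  dcark_class (DCarkData (@dir_edges M N)) = dcark_class (directed_by N).
Proof.
move=> hM hMN; have hN := hyperbolic_eq_or_inv hMN hM; rewrite directed_byP //.
have NN : eq_or_inv N N by left.
apply/seteqP; split=> d [hd]; have [M' [N' [hM' hMN' dE]]] := directed_carkP hd;
  subst d => /dcark_iso_dir_edges h; split => //;
  by apply/dcark_iso_dir_edges => //; exact: h.
Qed.

Lemma dcark_class_eq M M' : hyperbolic M -> hyperbolic M' ->
  dcark_class (directed_by M) = dcark_class (directed_by M') <->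
  exists V, M' = (M ^ V)%g.
Proof.
move=> hM hM'; have MM : eq_or_inv M M by left.
have MM' : eq_or_inv M' M' by left.
split=> [e|[V M'E]].
  have : dcark_class (directed_by M') (directed_by M').
    split; first exact: directed_by_directed.
    rewrite directed_byP //; apply/dcark_iso_dir_edges => //.
    by exists 1%g; rewrite conjg1.
  by rewrite -e => -[_]; rewrite !directed_byP // => /dcark_iso_dir_edges; apply.
rewrite !directed_byP //; apply/seteqP; split=> d [hd];
  have [K [N [hK hKN dE]]] := directed_carkP hd; subst d;
  move=> /dcark_iso_dir_edges h; split=> //; apply/dcark_iso_dir_edges => //.
  have [//|//|//|//|U ->] := h; exists (V^-1 * U)%g.
  by rewrite M'E -conjgM mulVKg.
have [//|//|//|//|U ->] := h; exists (V * U)%g.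
by rewrite M'E -conjgM.
Qed.

Lemma prim_cark_classesP c : prim_cark_classes c <->
  exists M, [/\ hyperbolic M, prim M & c = dcark_class (directed_by M)].
Proof.
split=> [[d [hd pd] <-]|[M [hM pM ->]]].
  have [M [N [hM hMN dE]]] := directed_carkP hd; subst d.
  exists N; split; [exact: hyperbolic_eq_or_inv hMN hM| |exact: dcark_class_dir_edges].
  exact/(is_primitive_carkP hM hMN).
exists (directed_by M) => //; split; first exact: directed_by_directed.
by rewrite directed_byP //; apply/is_primitive_carkP => //; left.
Qed.

Lemma bqf_classP f g : bqf_class f = bqf_class g <-> exists V, g = bqf_act V f.
Proof.
split=> [e|[V ->]].
  have : bqf_class g g by exists 1%g => //; exact: bqf_act1.
  by rewrite -e => -[V _ <-]; exists V.
apply/seteqP; split=> h [U _ <-].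
  by exists (V^-1 * U)%g; rewrite // -bqf_actM mulVKg.
by exists (V * U)%g; rewrite // bqf_actM.
Qed.

Theorem corollary4p8 :
  exists Phi : set dcark_data -> set bqf,
    set_bij prim_cark_classes bqf_classes Phi /\
    (forall M : PSL2Z, hyperbolic M -> is_primitive_cark (directed_by M) ->
       is_directed_cark (directed_by M) /\
       Phi (dcark_class (directed_by M)) = bqf_class (form_of M)).
Proof.
(* All primitive [M] directing [c] are gathered; they are conjugate, so their forms share one
   class. *)
pose Phi (c : set dcark_data) : set bqf := [set g | exists M, [/\ hyperbolic M, prim M,
  c = dcark_class (directed_by M) & bqf_class (form_of M) g]].
have PhiE M : hyperbolic M -> prim M ->
    Phi (dcark_class (directed_by M)) = bqf_class (form_of M).
  move=> hM pM; apply/seteqP; split=> [g [M' [hM' pM' /dcark_class_eq e]]|g hg].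
    have [//|//|V ->] := e; have [_ ->] := form_ofJ V hM.
    have /bqf_classP <- // : exists U, bqf_act V (form_of M) = bqf_act U (form_of M).
    by exists V.
  by exists M.
exists Phi; split; last first.
  move=> M hM pM; split; first exact: directed_by_directed.
  apply: PhiE => //; move: pM; rewrite directed_byP //.
  by move/is_primitive_carkP; apply => //; left.
split.
- move=> _ /prim_cark_classesP[M [hM pM ->]]; rewrite PhiE //.
  have [d0 ns] := form_of_disc hM.
  exists (form_of M) => //; split=> //; first exact: form_of_prim.
  by split=> //; exact: disc_mod4.
- move=> c c' /set_mem/prim_cark_classesP[M [hM pM ->]].
  move=> /set_mem/prim_cark_classesP[M' [hM' pM' ->]].
  (* [M ^ V] is primitive and has the form of [M'], hence equals it. *)
  rewrite !PhiE // => /bqf_classP[V e]; apply/dcark_class_eq => //; exists V.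
  have [hJ fJ] := form_ofJ V hM.
  apply: prim_form_inj => //; last by rewrite fJ.
  move=> K k k1 KE; apply: (pM (K ^ V^-1)%g k k1).
  by rewrite -conjXg -KE conjgK.
- move=> _ [f [fp _ [d0 _ ns]] <-].
  have [M [hM pM fM]] := exists_form fp d0 ns.
  exists (dcark_class (directed_by M)); last by rewrite PhiE // fM.
  by apply/prim_cark_classesP; exists M.
Qed.
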